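(* Let $n\ge 3$, let $R$ be a commutative ring, and let $(A,\Lambda)$ be a form algebra over $R$ such that $A$ is a quasi-finite $R$-algebra. Let $m\ge 1$ and let $(I_i,\Gamma_i)$, $i=0,\dots,m$, be form ideals of $(A,\Lambda)$. Consider an arbitrary configuration of brackets $[\![\ldots]\!]$ and assume that the outermost pair of brackets splits between positions $k$ and $k+1$, i.e. $[\![G_0,\dots,G_m]\!]=\big[[\![G_0,\dots,G_k]\!],[\![G_{k+1},\dots,G_m]\!]\big]$. Then $$[\![\mathrm{EU}(2n,I_0,\Gamma_0),\mathrm{EU}(2n,I_1,\Gamma_1),\ldots,\mathrm{EU}(2n,I_m,\Gamma_m)]\!]$$ $$=\Big[\mathrm{EU}\big(2n,(I_0,\Gamma_0)\circ\ldots\circ(I_k,\Gamma_k)\big),\ \mathrm{EU}\big(2n,(I_{k+1},\Gamma_{k+1})\circ\ldots\circ(I_m,\Gamma_m)\big)\Big],$$ where the bracketing of the (non-associative) symmetrised products of form ideals on the right-hand side corresponds to the bracketing of the commutators on the left-hand side.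
   Context: Form rings. $R$ is a commutative ring with $1$, $A$ a (not necessarily commutative) $R$-algebra with $1$, with an involution $a\mapsto\bar a$ (additive, $\overline{ab}=\bar b\bar a$, $\bar{\bar a}=a$). Fix $\lambda\in\mathrm{Cent}(A)$ with $\lambda\bar\lambda=1$. Put $\Lambda_{\min}=\{a-\lambda\bar a: a\in A\}$, $\Lambda_{\max}=\{a\in A: a=-\lambda\bar a\}$. A form parameter is an additive subgroup $\Lambda$ with $\Lambda_{\min}\subseteq\Lambda\subseteq\Lambda_{\max}$ and $a\Lambda\bar a\subseteq\Lambda$ for all $a\in A$; $(A,\Lambda)$ is then a form ring. It is a form algebra over $R$ if the involution leaves $R$ invariant ($\bar R=R$). $A$ is quasi-finite over $R$ if there is a direct system of $R$-subalgebras $A_i$ of $A$, each finitely generated as an $R$-module, with $\varinjlim A_i=A$. Form ideals. For a two-sided ideal $I$ with $\bar I=I$ put $\Gamma_{\max}(I)=I\cap\Lambda$ and $\Gamma_{\min}(I)=\{\xi-\lambda\bar\xi:\xi\in I\}+\langle\xi\alpha\bar\xi:\xi\in I,\alpha\in\Lambda\rangle$ ($\langle\cdot\rangle$ = additive subgroup generated). A relative form parameter of level $I$ is an additive subgroup $\Gamma$ with $\Gamma_{\min}(I)\subseteq\Gamma\subseteq\Gamma_{\max}(I)$ and $a\Gamma\bar a\subseteq\Gamma$ for all $a\in A$; then $(I,\Gamma)$ is a form ideal. The symmetrised product of form ideals is $$(I,\Gamma)\circ(J,\Delta)=\big(IJ+JI,\ \Gamma_{\min}(IJ+JI)+{}^J\Gamma+{}^I\Delta\big),$$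 where ${}^J\Gamma=\langle\xi\gamma\bar\xi:\xi\in J,\gamma\in\Gamma\rangle$ and ${}^I\Delta=\langle\xi\delta\bar\xi:\xi\in I,\delta\in\Delta\rangle$. A product with a single factor is that factor. Unitary groups. Index rows and columns of $2n\times 2n$ matrices by $\{1,\dots,n,-n,\dots,-1\}$, with $\varepsilon(i)=1$ for $i>0$ and $\varepsilon(i)=-1$ for $i<0$. On the right module $V=A^{2n}$ (columns) let $f(u,v)=\bar u_1v_{-1}+\dots+\bar u_nv_{-n}$, $h(u,v)=f(u,v)+\lambda\overline{f(v,u)}$, $q(u)=f(u,u)\bmod\Lambda$. $\mathrm{GU}(2n,A,\Lambda)$ is the group of $g\in\mathrm{GL}(2n,A)$ with $h(gu,gv)=h(u,v)$ and $q(gu)=q(u)$ for all $u,v\in V$. Elementary unitary transvections: for $i\ne\pm j$ and $\xi\in A$, $T_{ij}(\xi)=e+\xi e_{ij}-\lambda^{(\varepsilon(j)-\varepsilon(i))/2}\bar\xi e_{-j,-i}$; and for $\alpha\in\lambda^{-(\varepsilon(i)+1)/2}\Lambda$, $T_{i,-i}(\alpha)=e+\alpha e_{i,-i}$. $\mathrm{EU}(2n,A,\Lambda)$ is the group generated by all of them. Relative subgroups. $\mathrm{FU}(2n,I,\Gamma)$ is generated by $T_{ij}(\xi)$ with $\xi\in I$ if $i\ne\pm j$ and $\xi\in\lambda^{-(\varepsilon(i)+1)/2}\Gamma$ if $i=-j$. $\mathrm{EU}(2n,I,\Gamma)$, also written $\mathrm{EU}(2n,(I,\Gamma))$, is the normal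 closure of $\mathrm{FU}(2n,I,\Gamma)$ in $\mathrm{EU}(2n,A,\Lambda)$. Commutators. $[x,y]=xyx^{-1}y^{-1}$; for subgroups $H,K$, $[H,K]$ is the subgroup generated by all $[x,y]$, $x\in H$, $y\in K$. For subgroups $G_0,\dots,G_m$ of a group, $[\![G_0,G_1,\dots,G_m]\!]$ denotes the multiple commutator formed, keeping the order $G_0,\dots,G_m$, by an arbitrary full binary bracketing with $[\cdot,\cdot]$ (for a single subgroup, $[\![G_0]\!]=G_0$). *)

(* Defs.v *)
From HB Require Import structures.
From mathcomp Require Import all_boot all_order all_algebra.
From mathcomp Require Import boolp classical_sets.

Set Implicit Arguments.
Unset Strict Implicit.
Unset Printing Implicit Defensive.

Import GRing.Theory.

Local Open Scope classical_set_scope.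
Local Open Scope ring_scope.

Section GeneralLinearGroup.
Variables (N : nat) (A : pzRingType).

(* [A] is not commutative, so [unitmx] is not available: an element of GL(N, A)
   is a matrix bundled with its (unique) two-sided inverse. *)
Definition GL : Type :=
  {p : 'M[A]_N * 'M[A]_N | (p.1 *m p.2 == 1%:M) && (p.2 *m p.1 == 1%:M)}.

HB.instance Definition _ := Choice.on GL.

Definition GLmx (g : GL) : 'M[A]_N := (val g).1.

Lemma GLmx_inj : injective GLmx.
Proof.
move=> [[x x'] /= px] [[y y'] /= py]; rewrite /GLmx /= => exy.
apply: val_inj => /=; subst y; congr pair.
have /andP[_ /eqP x'x] := px; have /andP[/eqP xy' _] := py.
by rewrite -[LHS]mulmx1 -xy' mulmxA x'x mul1mx.
Qed.

Lemma GL_one_subproof :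
  ((1%:M : 'M[A]_N) *m 1%:M == 1%:M) && ((1%:M : 'M[A]_N) *m 1%:M == 1%:M).
Proof. by rewrite !mulmx1 eqxx. Qed.

Lemma GL_mul_subproof (g h : GL) :
  ((val g).1 *m (val h).1 *m ((val h).2 *m (val g).2) == 1%:M) &&
  ((val h).2 *m (val g).2 *m ((val g).1 *m (val h).1) == 1%:M).
Proof.
case: g h => [[x x'] /= /andP[/eqP xx' /eqP x'x]].
case=> [[y y'] /= /andP[/eqP yy' /eqP y'y]].
rewrite !mulmxA -(mulmxA x) yy' mulmx1 xx' -(mulmxA y') x'x mulmx1 y'y.
by rewrite !eqxx.
Qed.

Lemma GL_inv_subproof (g : GL) :
  ((val g).2 *m (val g).1 == 1%:M) && ((val g).1 *m (val g).2 == 1%:M).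
Proof. by rewrite andbC (valP g). Qed.

Definition GL_one : GL := exist _ (1%:M, 1%:M) GL_one_subproof.
Definition GL_mul (g h : GL) : GL :=
  exist _ ((val g).1 *m (val h).1, (val h).2 *m (val g).2)
    (GL_mul_subproof g h).
Definition GL_inv (g : GL) : GL :=
  exist _ ((val g).2, (val g).1) (GL_inv_subproof g).

Lemma GL_mulA : associative GL_mul.
Proof. by move=> x y z; apply: GLmx_inj; rewrite /GLmx /= mulmxA. Qed.
Lemma GL_mul1 : left_id GL_one GL_mul.
Proof. by move=> x; apply: GLmx_inj; rewrite /GLmx /= mul1mx. Qed.
Lemma GL_mulr1 : right_id GL_one GL_mul.
Proof. by move=> x; apply: GLmx_inj; rewrite /GLmx /= mulmx1. Qed.
Lemma GL_mulV : left_inverse GL_one GL_inv GL_mul.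
Proof.
by move=> x; apply: GLmx_inj; case/andP: (valP x) => _ /eqP; rewrite /GLmx.
Qed.
Lemma GL_mulrV : right_inverse GL_one GL_inv GL_mul.
Proof.
by move=> x; apply: GLmx_inj; case/andP: (valP x) => /eqP; rewrite /GLmx.
Qed.

HB.instance Definition _ := isGroup.Build GL
  GL_mulA GL_mul1 GL_mulr1 GL_mulV GL_mulrV.

End GeneralLinearGroup.

Section Subgroups.
Variable G : groupType.
Local Open Scope group_scope.

Definition group_span (S : set G) : set G :=
  smallest (fun H : set G => group_closed [in H]) S.

Definition normal_closure (K S : set G) : set G :=
  group_span [set x * s * x^-1 | x in K & s in S].

(* Not the library's [[~ x, y]], which is x^-1 * y^-1 * x * y. *)
Definition comm_elt (x y : G) : G := x * y * x^-1 * y^-1.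

Definition comm_subgroup (H K : set G) : set G :=
  group_span [set comm_elt x y | x in H & y in K].

End Subgroups.

(* Full binary bracketings of a word, and their evaluation for a binary
   operation [op] on the word [G s, G s.+1, ..., G (s + size_bracketing b).-1]. *)
Inductive bracketing : Type :=
| Single
| Bracket of bracketing & bracketing.

Fixpoint size_bracketing (b : bracketing) : nat :=
  match b with
  | Single => 1
  | Bracket l r => size_bracketing l + size_bracketing r
  end.

Fixpoint eval_bracketing (T : Type) (op : T -> T -> T) (G : nat -> T)
    (b : bracketing) (s : nat) : T :=
  match b with
  | Single => G s
  | Bracket l r =>
      op (eval_bracketing op G l s)
         (eval_bracketing op G r (s + size_bracketing l))
  end.

Record formRing (A : pzRingType) := FormRing {
  bar : A -> A;
  barD : forall a b, bar (a + b) = bar a + bar b;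
  barM : forall a b, bar (a * b) = bar b * bar a;
  barK : forall a, bar (bar a) = a;
  lam : A;
  lam_central : forall a, lam * a = a * lam;
  lam_bar : lam * bar lam = 1;
  Lambda : set A;
  Lambda_zmod : zmod_closed [in Lambda];
  Lambda_min : [set a - lam * bar a | a in [set: A]] `<=` Lambda;
  Lambda_max : Lambda `<=` [set a | a = - (lam * bar a)];
  Lambda_bar : forall a x, Lambda x -> Lambda (a * x * bar a)
}.

(* An [R]-algebra structure on [A] is given by its structure morphism
   [phi : R -> A] with central image; unlike with [algType R], [A] may be the
   zero ring. *)
Section Algebras.
Variables (R : comPzRingType) (A : pzRingType) (phi : {rmorphism R -> A}).

Definition is_algebra : Prop := forall r a, phi r * a = a * phi r.

Definition is_form_algebra (F : formRing A) : Prop :=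
  bar F @` range phi = range phi.

Definition is_subalgebra (S : set A) : Prop :=
  subring_closed [in S] /\ forall r a, S a -> S (phi r * a).

Definition module_finite (S : set A) : Prop :=
  exists (d : nat) (e : 'I_d -> A),
    S = [set \sum_(i < d) phi (c i) * e i | c in [set: 'I_d -> R]].

(* The transition maps are the inclusions, so that the direct limit is the
   union. *)
Definition quasi_finite : Prop :=
  exists (J : Type) (le : J -> J -> Prop) (B : J -> set A),
    [/\ (forall i, le i i) /\ (forall i j k, le i j -> le j k -> le i k),
        forall i j, exists k, le i k /\ le j k,
        forall i j, le i j -> B i `<=` B j,
        forall i, is_subalgebra (B i) /\ module_finite (B i)
      & \bigcup_(i in [set: J]) B i = [set: A]].

End Algebras.

Section FormIdeals.
Variables (A : pzRingType) (F : formRing A).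

Definition add_span (S : set A) : set A :=
  smallest (fun H : set A => zmod_closed [in H]) S.

Definition add_set (X Y : set A) : set A := [set x + y | x in X & y in Y].

Definition mul_span (X Y : set A) : set A :=
  add_span [set x * y | x in X & y in Y].

Definition bar_span (J G : set A) : set A :=
  add_span [set xi * g * bar F xi | xi in J & g in G].

Definition is_invariant_ideal (I : set A) : Prop :=
  [/\ zmod_closed [in I],
      forall a x, I x -> I (a * x) /\ I (x * a)
    & bar F @` I = I].

Definition Gamma_max (I : set A) : set A := I `&` Lambda F.

Definition Gamma_min (I : set A) : set A :=
  add_set [set xi - lam F * bar F xi | xi in I] (bar_span I (Lambda F)).

Definition is_form_ideal (P : set A * set A) : Prop :=
  let: (J, Gamma) := P in
  [/\ is_invariant_ideal J,
      zmod_closed [in Gamma],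
      Gamma_min J `<=` Gamma,
      Gamma `<=` Gamma_max J
    & forall a x, Gamma x -> Gamma (a * x * bar F a)].

Definition form_prod (P Q : set A * set A) : set A * set A :=
  let: (J1, Gamma1) := P in let: (J2, Gamma2) := Q in
  let K := add_set (mul_span J1 J2) (mul_span J2 J1) in
  (K, add_set (add_set (Gamma_min K) (bar_span J2 Gamma1)) (bar_span J1 Gamma2)).

End FormIdeals.

Section ElementaryUnitary.
Variables (n : nat) (A : pzRingType) (F : formRing A).

(* The ordinals 0, ..., 2n-1 stand for the indices 1, ..., n, -n, ..., -1 in
   this order; in particular [rev_ord i] stands for the opposite index -i. *)
Definition eps (i : 'I_(2 * n)) : int := if (i < n)%N then 1 else -1.

(* lam^-1 = bar lam *)
Definition lamz (z : int) : A :=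
  match z with
  | Posz k => lam F ^+ k
  | Negz k => bar F (lam F) ^+ k.+1
  end.

Definition T_short (i j : 'I_(2 * n)) (xi : A) : 'M[A]_(2 * n) :=
  1%:M + xi *: delta_mx i j
  - (lamz ((eps j - eps i) %/ 2)%Z * bar F xi)
      *: delta_mx (rev_ord j) (rev_ord i).

Definition T_long (i : 'I_(2 * n)) (alpha : A) : 'M[A]_(2 * n) :=
  1%:M + alpha *: delta_mx i (rev_ord i).

Definition T_generators (P : set A * set A) : set (GL (2 * n) A) :=
  [set g | (exists i j xi, [/\ i != j, i != rev_ord j, P.1 xi
                             & GLmx g = T_short i j xi])
        \/ (exists i gam, P.2 gam /\
              GLmx g = T_long i (lamz ((- (eps i + 1)) %/ 2)%Z * gam))].

Definition FU (P : set A * set A) : set (GL (2 * n) A) :=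
  group_span (T_generators P).

Definition EU_abs : set (GL (2 * n) A) := FU ([set: A], Lambda F).

Definition EU (P : set A * set A) : set (GL (2 * n) A) :=
  normal_closure EU_abs (FU P).

End ElementaryUnitary.

Arguments EU_abs n {A} F.
Arguments EU n {A} F P.

(* Main.v *)
Require Import Defs.
From HB Require Import structures.
From mathcomp Require Import all_boot all_order all_algebra.
From mathcomp Require Import boolp classical_sets.
From mathcomp Require Import generic_quotient zify.

(** Write [M = EU(P o Q)] and [C = [EU P, EU Q]] for form ideals [P] and [Q].
    By induction on the bracketing, a bracketed commutator of two or more
    factors is [[EU X, EU Y]], where [X o Y] is the bracketed product of the
    form ideals.  One more commutator is then absorbed by the two identities
      [[[EU P, EU Q], EU R] = [EU(P o Q), EU R]] ([triple_commutator]) and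
      [[[EU P, EU Q], [EU R, EU S]] = [EU(P o Q), EU(R o S)]]
    ([quadruple_commutator]).  The inclusion from right to left holds because
    [M] is contained in [C], by the Steinberg relations ([rel_EU_prod_sub]).

    For the other inclusion, call [y = [x, x']] an SL2 commutator when [x] is
    in a root subgroup of level [P] and [x'] in the opposite root subgroup of
    level [Q].  Two facts about these carry the proof.  First, a normal subgroup
    that contains [M] and all SL2 commutators contains [C]
    ([mutual_commutator_sub]).  Secondly, SL2 commutators are central modulo [M]
    in the whole elementary group ([sl2_comm_central]).  Consequently a
    Weyl group element conjugates [y] to another SL2 commutator and changes it
    only by a factor in [M]: inside any commutator whose [M]-part is under
    control, the root that carries [y] may be replaced by any root of the same
    length ([sl2_transfer], [movable_short], [movable_long]).

    To see that [[y, g]] is in [[M, EU R]] for a root element [g] of level [R],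
    move [y] either to a root subgroup that commutes with [g], or, when both
    roots are short, to a root that spans an A2 system with the root of [g];
    there [[y, g]] is an explicit product of two root elements
    ([short_adjacent]).  For two SL2 commutators [y] and [y'], move them to
    commuting positions, unless both are short: for [n = 3] two short roots
    always share an index.  This case is a computation with the Steinberg
    relations of GL3 ([short_short_commute]).  Modulo [[EU(P o Q), EU(R o S)]],
    conjugating [y'] by [y] multiplies it by a product of values of one additive
    function, and the arguments of these values add up to zero because the
    matrix of [y] is inverse to that of its inverse.

    The argument uses only the Steinberg relations, which are collected in
    [unitary_relations]; matrices enter at the end, to check these relations.  A
    root is a pair [(i, j)] of distinct indices, identified with [(-j, -i)]; it
    is long when [j = -i] and short otherwise.  Short and long roots
    are treated uniformly by means of height functions: an integer function [f]
    on the indices with [f (-i) = - f i] gives the root [(i, j)] the height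
    [f i - f j].  If the height of a root is zero, the roots of positive height
    generate a group that is normalised by the root subgroups of that root and
    of its opposite, like the unipotent radical of a parabolic subgroup. *)

Set Implicit Arguments.
Unset Strict Implicit.
Unset Printing Implicit Defensive.

Import Order.TTheory GRing.Theory Num.Theory.

(** * Form ideals and their symmetrised products *)

Section AdditiveSubgroups.
Local Open Scope classical_set_scope.
Local Open Scope ring_scope.
Variable A : pzRingType.
Implicit Types S H : set A.

Lemma zmod_closedP S : zmod_closed [in S] <->
  S 0 /\ forall x y, S x -> S y -> S (x - y).
Proof.
split=> -[S0 SB]; split; rewrite ?inE // in S0 *.
- by move=> x y Sx Sy; have := SB x y; rewrite !inE; apply.
- by move=> x y; rewrite !inE; apply: SB.
Qed.

Lemma zmod0 S : zmod_closed [in S] -> S 0.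
Proof. by case/zmod_closedP. Qed.

Lemma zmodB S : zmod_closed [in S] -> forall x y, S x -> S y -> S (x - y).
Proof. by case/zmod_closedP. Qed.

Lemma zmodN S : zmod_closed [in S] -> forall x, S x -> S (- x).
Proof. by move=> zS x Sx; rewrite -sub0r; apply: zmodB => //; apply: zmod0. Qed.

Lemma zmodD S : zmod_closed [in S] -> forall x y, S x -> S y -> S (x + y).
Proof. by move=> zS x y Sx Sy; rewrite -(opprK y); apply: zmodB => //; apply: zmodN. Qed.

Lemma add_span_min S H :
  zmod_closed [in H] -> S `<=` H -> add_span S `<=` H.
Proof. by move=> zH SH x; apply. Qed.

Lemma sub_add_span S : S `<=` add_span S.
Proof. by move=> x Sx H [_]; apply. Qed.

Lemma add_span_zmod S : zmod_closed [in add_span S].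
Proof.
apply/zmod_closedP; split=> [|x y Sx Sy] H HS; case: (HS) => zH _.
  exact: zmod0.
by apply: zmodB => //; [apply: Sx | apply: Sy].
Qed.

Lemma add_span0 S : add_span S 0.
Proof. exact: (zmod0 (@add_span_zmod _)). Qed.

Lemma add_set_zmod S H :
  zmod_closed [in S] -> zmod_closed [in H] -> zmod_closed [in add_set S H].
Proof.
move=> zS zH; apply/zmod_closedP; split.
  by exists 0; [exact: zmod0|exists 0; [exact: zmod0|rewrite addr0]].
move=> _ _ [a Sa [b Hb <-]] [a' Sa' [b' Hb' <-]].
exists (a - a'); first exact: zmodB.
by exists (b - b'); [exact: zmodB | rewrite opprD addrACA].
Qed.

Lemma add_set_min S H K : zmod_closed [in K] -> S `<=` K -> H `<=` K ->
  add_set S H `<=` K.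
Proof.
by move=> zK SK HK _ [a /SK Ka [b /HK Kb <-]]; apply: zmodD.
Qed.

Lemma sub_add_setl S H : H 0 -> S `<=` add_set S H.
Proof. by move=> H0 x Sx; exists x => //; exists 0 => //; rewrite addr0. Qed.

Lemma sub_add_setr S H : S 0 -> H `<=` add_set S H.
Proof. by move=> S0 x Hx; exists 0 => //; exists x => //; rewrite add0r. Qed.

Lemma add_setC S H : add_set S H = add_set H S.
Proof.
by apply/seteqP; split=> _ [x Sx [y Hy <-]]; exists y => //; exists x => //;
  rewrite addrC.
Qed.

Lemma add_setAC S H K :
  add_set (add_set S H) K = add_set (add_set S K) H.
Proof.
by apply/seteqP; split=> _ [_ [x Sx [y Hy <-]] [z Kz <-]];
  exists (x + z) => //; [exists x=> //; exists z| exists y => //; rewrite addrAC|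
  exists x=> //; exists z | exists y => //; rewrite addrAC].
Qed.

End AdditiveSubgroups.

Section FormIdealTheory.
Local Open Scope classical_set_scope.
Local Open Scope ring_scope.
Variables (A : pzRingType) (F : formRing A).
Implicit Types P Q : set A * set A.
Notation bar := (bar F).
Notation lam := (lam F).
Notation L := (Lambda F).

Lemma bar0 : bar 0 = 0.
Proof. by apply: (addrI (bar 0)); rewrite -barD !addr0. Qed.

Lemma barN a : bar (- a) = - bar a.
Proof. by apply: (addrI (bar a)); rewrite -barD !subrr bar0. Qed.

Lemma barB a b : bar (a - b) = bar a - bar b.
Proof. by rewrite barD barN. Qed.

Lemma bar1 : bar 1 = 1.
Proof. by rewrite -[LHS]mulr1 -{2}[1](barK F) -barM mulr1 barK. Qed.

Lemma Lambda_subgroup : zmod_closed [in L]. Proof. exact: Lambda_zmod. Qed.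

Lemma Lambda_minE a : L (a - lam * bar a).
Proof. by apply: (@Lambda_min _ F); exists a. Qed.

Lemma Lambda_maxE a : L a -> a = - (lam * bar a).
Proof. exact: (@Lambda_max _ F). Qed.

Definition top_ideal : set A * set A := ([set: A], L).

Lemma top_ideal_form : is_form_ideal F top_ideal.
Proof.
split.
- split=> //; first by apply/zmod_closedP.
  by apply/seteqP; split=> // x _; exists (bar x); rewrite // barK.
- exact: Lambda_subgroup.
- apply: add_set_min; first exact: Lambda_subgroup.
    by move=> _ [a _ <-]; apply: Lambda_minE.
  apply: add_span_min; first exact: Lambda_subgroup.
  by move=> _ [a _ [x Lx <-]]; apply: Lambda_bar.
- by move=> x.
- by move=> a x; apply: Lambda_bar.
Qed.

Section Closure.
Variables (P : set A * set A).
Hypothesis hP : is_form_ideal F P.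

Lemma ideal_zmod : zmod_closed [in P.1].
Proof. by move: hP; case: P => J G /= [[? _ _] _ _ _ _]. Qed.

Lemma param_zmod : zmod_closed [in P.2].
Proof. by move: hP; case: P => J G /= [_ ? _ _ _]. Qed.

Lemma ideal_mull a x : P.1 x -> P.1 (a * x).
Proof. by move: hP; case: P => J G /= [[_ H _] _ _ _ _] /(H a)[]. Qed.

Lemma ideal_mulr a x : P.1 x -> P.1 (x * a).
Proof. by move: hP; case: P => J G /= [[_ H _] _ _ _ _] /(H a)[]. Qed.

Lemma ideal_bar x : P.1 x -> P.1 (bar x).
Proof.
by move: hP; case: P => J G /= [[_ _ H] _ _ _ _] /= Jx; rewrite -H; exists x.
Qed.

Lemma param_ideal x : P.2 x -> P.1 x.
Proof. by move: hP; case: P => J G /= [_ _ _ H _] /H[]. Qed.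

Lemma param_Lambda x : P.2 x -> L x.
Proof. by move: hP; case: P => J G /= [_ _ _ H _] /H[]. Qed.

Lemma param_bar a x : P.2 x -> P.2 (a * x * bar a).
Proof. by move: hP; case: P => J G /= [_ _ _ _ H] /(H a). Qed.

Lemma param_min x : P.1 x -> P.2 (x - lam * bar x).
Proof.
move: hP; case: P => J G /= [_ _ H _ _] /= Jx; apply: H.
by apply: sub_add_setl; [exact: add_span0 | exists x].
Qed.

Lemma param_sandwich x a : P.1 x -> L a -> P.2 (x * a * bar x).
Proof.
move: hP; case: P => J G /= [[z _ _] _ H _ _] /= Jx La; apply: H.
apply: sub_add_setr; first by exists 0; rewrite ?bar0 ?mulr0 ?subr0 //; apply: zmod0.
by apply: sub_add_span; exists x => //; exists a.
Qed.

End Closure.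

Lemma form_prodC P Q : form_prod F P Q = form_prod F Q P.
Proof. by case: P Q => [J G] [J' G'] /=; rewrite add_setC add_setAC. Qed.

Section Products.
Variables (P Q : set A * set A).
Hypotheses (hP : is_form_ideal F P) (hQ : is_form_ideal F Q).
Notation PQ := (form_prod F P Q).

(** Both components of a product are spanned by explicit elements, so that a
    closed property needs to be checked on these only; all later arguments on
    products of form ideals go through this lemma and the next one. *)
Lemma form_prod_ideal_ind (S : set A) : zmod_closed [in S] ->
  (forall a b, P.1 a -> Q.1 b -> S (a * b)) ->
  (forall a b, P.1 a -> Q.1 b -> S (b * a)) -> PQ.1 `<=` S.
Proof.
case: P Q => [J G] [J' G'] /= zS S1 S2.
apply: add_set_min => //; apply: add_span_min => // _ [a Pa [b Qb <-]].
  exact: S1.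
exact: S2.
Qed.

Lemma form_prod_param_ind (S : set A) : zmod_closed [in S] ->
  (forall k, PQ.1 k -> S (k - lam * bar k)) ->
  (forall k a, PQ.1 k -> L a -> S (k * a * bar k)) ->
  (forall b g, Q.1 b -> P.2 g -> S (b * g * bar b)) ->
  (forall a d, P.1 a -> Q.2 d -> S (a * d * bar a)) -> PQ.2 `<=` S.
Proof.
case: P Q => [J G] [J' G'] /= zS S1 S2 S3 S4.
do 3?[apply: add_set_min => //]; first by move=> _ [k Kk <-]; exact: S1.
all: apply: add_span_min => // _ [a Pa [b Qb <-]].
- exact: S2.
- exact: S3.
- exact: S4.
Qed.

Lemma form_prod_zmod1 : zmod_closed [in PQ.1].
Proof. by case: P Q => [J G] [J' G'] /=; apply: add_set_zmod; apply: add_span_zmod. Qed.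

Lemma form_prod_mull a b : P.1 a -> Q.1 b -> PQ.1 (a * b).
Proof.
case: P Q => [J G] [J' G'] /= Ja Jb; apply: sub_add_setl.
  exact: add_span0.
by apply: sub_add_span; exists a => //; exists b.
Qed.

Lemma form_prod_mulr a b : P.1 a -> Q.1 b -> PQ.1 (b * a).
Proof.
case: P Q => [J G] [J' G'] /= Ja Jb; apply: sub_add_setr.
  exact: add_span0.
by apply: sub_add_span; exists b => //; exists a.
Qed.

(** One induction gives all closure properties of [IJ + JI] at once, since each
    of them moves a factor into [I] or into [J]. *)
Lemma form_prod_closed k : PQ.1 k ->
  [/\ forall a, PQ.1 (a * k), forall a, PQ.1 (k * a), PQ.1 (bar k), P.1 k & Q.1 k].
Proof.
pose S := [set k | [/\ forall a, PQ.1 (a * k), forall a, PQ.1 (k * a),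
  PQ.1 (bar k), P.1 k & Q.1 k]].
suff: PQ.1 `<=` S by apply.
have zK := form_prod_zmod1.
have [zP zQ] := (ideal_zmod hP, ideal_zmod hQ).
apply: form_prod_ideal_ind.
- apply/zmod_closedP; split.
    split=> [a|a|||]; rewrite ?mulr0 ?mul0r ?bar0; exact: zmod0.
  move=> x y [x1 x2 x3 x4 x5] [y1 y2 y3 y4 y5].
  by split=> [a|a|||]; rewrite ?mulrBr ?mulrBl ?barB; apply: zmodB.
- move=> a b Pa Qb; split=> [d|d|||].
  + by rewrite mulrA; apply: form_prod_mull => //; apply: ideal_mull.
  + by rewrite -mulrA; apply: form_prod_mull => //; apply: ideal_mulr.
  + by rewrite barM; apply: form_prod_mulr; apply: ideal_bar.
  + exact: ideal_mulr.
  + exact: ideal_mull.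
- move=> a b Pa Qb; split=> [d|d|||].
  + by rewrite mulrA; apply: form_prod_mulr => //; apply: ideal_mull.
  + by rewrite -mulrA; apply: form_prod_mulr => //; apply: ideal_mulr.
  + by rewrite barM; apply: form_prod_mull; apply: ideal_bar.
  + exact: ideal_mull.
  + exact: ideal_mulr.
Qed.

Lemma Gamma_min_zmod (J : set A) :
  zmod_closed [in J] -> zmod_closed [in Gamma_min F J].
Proof.
move=> zJ; apply: add_set_zmod; last exact: add_span_zmod.
apply/zmod_closedP; split.
  by exists 0; [exact: zmod0|rewrite bar0 mulr0 subr0].
move=> _ _ [x Jx <-] [y Jy <-]; exists (x - y); first exact: zmodB.
by rewrite barB mulrBr !opprB addrACA [RHS]addrACA [- _ + _]addrC.
Qed.

Lemma form_prod_zmod2 : zmod_closed [in PQ.2].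
Proof.
have := form_prod_zmod1; case: P Q => [J G] [J' G'] /= zK.
by do 2?[apply: add_set_zmod]; [apply: Gamma_min_zmod | apply: add_span_zmod..].
Qed.

Lemma form_prod_min : Gamma_min F PQ.1 `<=` PQ.2.
Proof.
case: P Q => [J G] [J' G'] /= x Kx.
by do 2?[apply: sub_add_setl; first exact: add_span0].
Qed.

Lemma form_prod_sandwichr b g : Q.1 b -> P.2 g -> PQ.2 (b * g * bar b).
Proof.
have := form_prod_zmod1; case: P Q => [J G] [J' G'] /= zK Jb Gg.
apply: sub_add_setl; first exact: add_span0.
apply: sub_add_setr; first exact: (zmod0 (Gamma_min_zmod _)).
by apply: sub_add_span; exists b => //; exists g.
Qed.

Lemma form_prod_sandwichl a d : P.1 a -> Q.2 d -> PQ.2 (a * d * bar a).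
Proof.
have := form_prod_zmod1; case: P Q => [J G] [J' G'] /= zK Ja Gd.
apply: sub_add_setr.
  by apply: (zmod0 (add_set_zmod _ _)); [apply: Gamma_min_zmod| apply: add_span_zmod].
by apply: sub_add_span; exists a => //; exists d.
Qed.

Lemma form_prod_form : is_form_ideal F PQ.
Proof.
have zK := form_prod_zmod1; have zG := form_prod_zmod2.
have H : forall k, PQ.1 k -> PQ.2 (k - lam * bar k).
  move=> k Kk; apply: form_prod_min; apply: sub_add_setl.
    exact: add_span0.
  by exists k.
have H' : forall k a, PQ.1 k -> L a -> PQ.2 (k * a * bar k).
  move=> k a Kk La; apply: form_prod_min; apply: sub_add_setr.
    by exists 0; [exact: zmod0|rewrite bar0 mulr0 subr0].
  by apply: sub_add_span; exists k => //; exists a.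
suff S : [/\ is_invariant_ideal F PQ.1, zmod_closed [in PQ.2],
  Gamma_min F PQ.1 `<=` PQ.2, PQ.2 `<=` Gamma_max F PQ.1
  & forall a x, PQ.2 x -> PQ.2 (a * x * bar a)].
  by move: S; case: PQ.
split=> //.
- split=> //; first by move=> a x /form_prod_closed[].
  apply/seteqP; split=> [_ [x /form_prod_closed[_ _ ? _ _] <-] //|x].
  by case/form_prod_closed=> _ _ ? _ _; exists (bar x); rewrite ?barK.
- exact: form_prod_min.
- apply: form_prod_param_ind.
  + apply/zmod_closedP; split.
      by split; [exact: zmod0 | apply: zmod0; exact: Lambda_subgroup].
    move=> x y [? ?] [? ?]; split; apply: zmodB => //; exact: Lambda_subgroup.
  + move=> k Kk; split; last exact: Lambda_minE.
    by apply: zmodB => //; case: (form_prod_closed Kk) => _ _ /form_prod_closed[].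
  + move=> k a Kk La; split; last exact: Lambda_bar.
    by rewrite -mulrA; case: (form_prod_closed Kk).
  + move=> b g Qb Pg; split; last exact/Lambda_bar/(param_Lambda hP).
    rewrite -mulrA; apply: form_prod_mulr => //; apply: ideal_mulr => //.
    exact: param_ideal.
  + move=> a d Pa Qd; split; last exact/Lambda_bar/(param_Lambda hQ).
    rewrite -mulrA; apply: form_prod_mull => //; apply: ideal_mulr => //.
    exact: param_ideal.
- move=> a.
  pose S := [set x | PQ.2 (a * x * bar a)]; suff: PQ.2 `<=` S by apply.
  have C x y : a * (x * y * bar x) * bar a = (a * x) * y * bar (a * x).
    by rewrite barM !mulrA.
  apply: form_prod_param_ind; rewrite /S /=.
  + apply/zmod_closedP; split; first by rewrite /= mulr0 mul0r; exact: zmod0.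
    by move=> x y; rewrite /= mulrBr mulrBl; apply: zmodB.
  + move=> k Kk; suff -> : a * (k - lam * bar k) * bar a =
       (a * k * bar a) - lam * bar (a * k * bar a).
      by apply: H; case: (form_prod_closed Kk) => /(_ a) /form_prod_closed[].
    by rewrite mulrBr mulrBl !barM barK !mulrA lam_central.
  + by move=> k x Kk Lx; rewrite C; apply: H' => //; case: (form_prod_closed Kk).
  + move=> b g Qb Pg; rewrite C; apply: form_prod_sandwichr => //.
    exact: ideal_mull.
  + move=> b g Qb Pg; rewrite C; apply: form_prod_sandwichl => //.
    exact: ideal_mull.
Qed.

End Products.

(** Levels do not grow under commutators with the absolute elementary group,
    which is the relative one of level [top_ideal]. *)
Lemma form_prod_top_sub P : is_form_ideal F P ->
  (form_prod F P top_ideal).1 `<=` P.1 /\ (form_prod F P top_ideal).2 `<=` P.2.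
Proof.
move=> hP; have [zI zG] := (ideal_zmod hP, param_zmod hP).
have S1 : (form_prod F P top_ideal).1 `<=` P.1.
  by apply: form_prod_ideal_ind => // a b Pa _;[apply: ideal_mulr| apply: ideal_mull].
split=> //; apply: form_prod_param_ind => //.
- by move=> k /S1 Pk; apply: param_min.
- by move=> k a /S1 Pk La; apply: param_sandwich.
- by move=> b g _ Pg; apply: param_bar.
- by move=> a d Pa Ld; apply: param_sandwich.
Qed.

End FormIdealTheory.

(** * Subgroups, commutators and quotients *)

Section Subgroups.
Local Open Scope classical_set_scope.
Local Open Scope group_scope.
Variable G : groupType.
Implicit Types (S H K N : set G) (x y z g : G).

Definition subgroup H : Prop :=
  [/\ H 1, forall x y, H x -> H y -> H (x * y) & forall x, H x -> H x^-1].

Definition normal H : Prop :=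
  subgroup H /\ forall g x, H x -> H (g * x * g^-1).

Lemma group_closedP H : group_closed [in H] <-> subgroup H.
Proof.
split=> [gH|[H1 HM HV]].
  split; first by case: gH; rewrite inE.
    by move=> x y Hx Hy; have := group_closedM gH (mem_set Hx) (mem_set Hy); rewrite inE.
  by move=> x Hx; have := group_closedV gH (mem_set Hx); rewrite inE.
split; first by rewrite inE.
by move=> x y; rewrite !inE => Hx Hy; apply/HM/HV.
Qed.

Lemma sub_group_span S : S `<=` group_span S.
Proof. by move=> x Sx H [_ SH]; apply: SH. Qed.

Lemma span_min S H : subgroup H -> S `<=` H -> group_span S `<=` H.
Proof. by move=> /group_closedP gH SH x Sx; apply: (Sx H). Qed.

Lemma span_subgroup S : subgroup (group_span S).
Proof.
split=> [|x y Sx Sy|x Sx] H HS; case: (HS) => /group_closedP[H1 HM HV] _ //.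
  by apply: HM; [exact: Sx | exact: Sy].
by apply: HV; exact: Sx.
Qed.

Lemma span_mono S S' : S `<=` S' -> group_span S `<=` group_span S'.
Proof.
by move=> SS'; apply: span_min (span_subgroup _) _ => x /SS'; apply: sub_group_span.
Qed.

Lemma span_conj S K g :
  (forall x, S x -> group_span K (g * x * g^-1)) ->
  forall x, group_span S x -> group_span K (g * x * g^-1).
Proof.
move=> HS; pose H := [set x | group_span K (g * x * g^-1)].
have [K1 KM KV] := span_subgroup K.
apply: (@span_min S H) => //; split; rewrite /H /=.
- by rewrite mulg1 mulgV.
- by move=> x y Hx Hy; have := KM _ _ Hx Hy; rewrite !mulgA mulgVK.
- by move=> x /KV; rewrite !invgM invgK mulgA.
Qed.

Lemma span_normal S : (forall g x, S x -> S (g * x * g^-1)) ->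
  normal (group_span S).
Proof.
move=> HS; split=> [|g x]; first exact: span_subgroup.
by apply: span_conj => y Sy; apply: sub_group_span; apply: HS.
Qed.

Lemma comm_eltV x y : (comm_elt x y)^-1 = comm_elt y x.
Proof. by rewrite /comm_elt !invgM !invgK !mulgA. Qed.

Lemma comm_eltE x y : x * y = comm_elt x y * y * x.
Proof. by rewrite /comm_elt !mulgVK. Qed.

Lemma comm_elt_conj x y : x * y * x^-1 = comm_elt x y * y.
Proof. by rewrite /comm_elt mulgVK. Qed.

Lemma comm_elt1P x y : comm_elt x y = 1 <-> commute x y.
Proof.
split=> [h|h]; first by rewrite /commute comm_eltE h mul1g.
by rewrite /comm_elt h mulgK mulgV.
Qed.

Lemma comm_elt_mul x y g : g * comm_elt x y * g^-1 =
  comm_elt (g * x * g^-1) (g * y * g^-1).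
Proof. by rewrite /comm_elt !invgM !invgK !mulgA !mulgVK. Qed.

Lemma comm_eltMl x y z :
  comm_elt (x * y) z = x * comm_elt y z * x^-1 * comm_elt x z.
Proof. by rewrite /comm_elt !invgM !mulgA !mulgVK. Qed.

Lemma comm_eltMr x y z :
  comm_elt x (y * z) = comm_elt x y * (y * comm_elt x z * y^-1).
Proof. by rewrite /comm_elt !invgM !mulgA !mulgVK. Qed.

Lemma comm_subgroupC H K : comm_subgroup H K = comm_subgroup K H.
Proof.
have sub S T : comm_subgroup S T `<=` comm_subgroup T S.
  have sTS := span_subgroup [set comm_elt x y | x in T & y in S].
  apply: (span_min sTS) => _ [x Sx [y Ty <-]]; rewrite -comm_eltV.
  case: sTS => _ _; apply; apply: sub_group_span; exists y => //; exists x => //.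
by apply/seteqP; split.
Qed.

Lemma comm_subgroup_mono H K H' K' : H `<=` H' -> K `<=` K' ->
  comm_subgroup H K `<=` comm_subgroup H' K'.
Proof.
move=> HH KK; apply: span_mono => _ [x /HH Hx [y /KK Ky <-]].
by exists x => //; exists y.
Qed.

Lemma comm_subgroup_normal H K :
  (forall g x, H x -> H (g * x * g^-1)) -> (forall g x, K x -> K (g * x * g^-1)) ->
  normal (comm_subgroup H K).
Proof.
move=> nH nK; apply: span_normal => g _ [x Hx [y Ky <-]].
by rewrite comm_elt_mul; exists (g * x * g^-1); [exact: nH|exists (g * y * g^-1); [exact: nK|]].
Qed.

Lemma comm_subgroupE H K x y : H x -> K y -> comm_subgroup H K (comm_elt x y).
Proof. by move=> Hx Ky; apply: sub_group_span; exists x => //; exists y. Qed.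

Lemma comm_span_right (T U : set G) x : subgroup U ->
  (forall v u, group_span T v -> U u -> U (v * u * v^-1)) ->
  (forall v, T v -> U (comm_elt x v)) ->
  forall v, group_span T v -> U (comm_elt x v).
Proof.
move=> [U1 UM UV] nU HT v Tv.
have [s1 sM sV] := span_subgroup T.
suff [] : (group_span T `&` [set v | U (comm_elt x v)]) v by [].
apply: (@span_min T) Tv; last by move=> w Tw; split; [exact: sub_group_span | exact: HT].
split.
- by split=> //=; rewrite (_ : comm_elt x 1 = 1) //; apply/comm_elt1P/commute1.
- move=> a b [Ta Ua] [Tb Ub]; split; first exact: sM.
  by rewrite /= comm_eltMr; apply: UM => //; apply: nU.
- move=> a [Ta Ua]; split; first exact: sV.
  rewrite /= (_ : comm_elt x a^-1 = a^-1 * (comm_elt x a)^-1 * a^-1^-1).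
    by apply: nU; [exact: sV|exact: UV].
  by rewrite comm_eltV /comm_elt !invgK !mulgA mulVg mul1g.
Qed.

Lemma comm_span_left (T U : set G) x : subgroup U ->
  (forall v u, group_span T v -> U u -> U (v * u * v^-1)) ->
  (forall v, T v -> U (comm_elt v x)) ->
  forall v, group_span T v -> U (comm_elt v x).
Proof.
move=> sU nU HT v Tv; case: (sU) => _ _ UV; rewrite -comm_eltV; apply: (UV).
apply: (comm_span_right sU nU) Tv => w Tw; rewrite -comm_eltV; apply: UV.
exact: HT.
Qed.

(** Closure under conjugation by the inverse has to be asked for: a subgroup of
    an infinite group may contain a proper conjugate of itself. *)
Lemma span_normalizes (T U : set G) : (forall v, T v -> T v^-1) ->
  (forall v u, T v -> U u -> U (v * u * v^-1)) ->
  forall v u, group_span T v -> U u -> U (v * u * v^-1).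
Proof.
move=> TV HT v u Tv; move: u.
pose H := [set v | forall u, U u -> U (v * u * v^-1) /\ U (v^-1 * u * v)].
suff Hv : H v by move=> u /Hv[].
apply: (@span_min T) Tv; last first.
  move=> w Tw u Uu; split; first exact: HT.
  by rewrite -{2}[w]invgK; apply: HT => //; apply: TV.
split.
- by move=> u Uu; rewrite invg1 !mul1g !mulg1.
- move=> a b Ha Hb u Uu; split; rewrite invgM.
    have [/Ha[h _] _] := Hb _ Uu; by move: h; rewrite !mulgA.
  have [_ /Hb[_ h]] := Ha _ Uu; by move: h; rewrite !mulgA.
- by move=> a Ha u /Ha[? ?]; rewrite invgK.
Qed.

Lemma comm_eltVl x y : comm_elt x^-1 y = x^-1 * (comm_elt x y)^-1 * x^-1^-1.
Proof. by rewrite comm_eltV /comm_elt !invgK !mulgA mulgVK. Qed.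

(** For a normal [T], to bound [[H, T]] by [N] it is enough to exhibit
    generators of [H], as a normal subgroup, whose commutators with [T] are
    in [N]. *)
Lemma comm_into_normal (N T : set G) : normal N ->
  (forall g x, T x -> T (g * x * g^-1)) ->
  normal [set x | forall y, T y -> N (comm_elt x y)].
Proof.
move=> [[N1 NM NV] NC] TC; split; first split.
- by move=> y _; rewrite (_ : comm_elt 1 y = 1) //; apply/comm_elt1P/commute_sym/commute1.
- move=> a b Ha Hb y Ty; rewrite comm_eltMl; apply: (NM); last exact: Ha.
  by apply: (NC); apply: Hb.
- by move=> a Ha y Ty; rewrite comm_eltVl; apply: (NC); apply: (NV); apply: Ha.
move=> g a Ha y Ty; rewrite (_ : comm_elt _ _ = g * comm_elt a (g^-1 * y * g^-1^-1) * g^-1).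
  by apply: (NC); apply: Ha; apply: TC.
by rewrite comm_elt_mul invgK !mulgA mulgV mul1g mulgK.
Qed.

Definition centralized (S : set G) : set G := [set x | forall y, S y -> commute x y].

Lemma centralized_subgroup S : subgroup (centralized S).
Proof.
split=> [y _|x x' cx cx' y Sy|x cx y Sy]; apply: commute_sym.
- exact: commute1.
- by apply: commuteM; apply: commute_sym; [apply: cx | apply: cx'].
- by apply/commuteV/commute_sym/cx.
Qed.

End Subgroups.

Section Preimage.
Local Open Scope classical_set_scope.
Local Open Scope group_scope.
Variables (G Q : groupType) (p : G -> Q).
Hypothesis pM : {morph p : x y / x * y}.

Lemma morph1 : p 1 = 1.
Proof. by apply: (mulgI (p 1)); rewrite -pM !mulg1. Qed.

Lemma morphV : {morph p : x / x^-1}.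
Proof. by move=> x; apply: (mulgI (p x)); rewrite -pM !mulgV morph1. Qed.

Lemma preimage_subgroup (H : set Q) : subgroup H -> subgroup (p @^-1` H).
Proof.
move=> [H1 HM HV]; split; rewrite /preimage /=; first by rewrite morph1.
  by move=> x y; rewrite pM; apply: HM.
by move=> x; rewrite morphV; apply: HV.
Qed.

Lemma morph_comm x y : p (comm_elt x y) = comm_elt (p x) (p y).
Proof. by rewrite /comm_elt !pM !morphV. Qed.

Lemma span_commute (S T : set G) :
  (forall x y, S x -> T y -> commute (p x) (p y)) ->
  forall x y, group_span S x -> group_span T y -> commute (p x) (p y).
Proof.
move=> ST x y Sx Ty.
have H : forall s, S s -> commute (p s) (p y).
  move=> s Ss; apply: commute_sym.
  have := @span_min _ T (p @^-1` centralized [set p s]) _ _ _ Ty (p s).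
  apply=> //; first exact/preimage_subgroup/centralized_subgroup.
  by move=> t Tt _ -> ; apply/commute_sym/ST.
have := @span_min _ S (p @^-1` centralized [set p y]) _ _ _ Sx (p y).
apply=> //; first exact/preimage_subgroup/centralized_subgroup.
by move=> s Ss _ ->; apply: H.
Qed.

Lemma image_span (S : set G) : p @` group_span S = group_span (p @` S).
Proof.
apply/seteqP; split=> [_ [x Sx <-]|].
  apply: (@span_min _ S (p @^-1` group_span (p @` S))) Sx => //.
    exact/preimage_subgroup/span_subgroup.
  by move=> y Sy; apply: sub_group_span; exists y.
have [S1 SM SV] := span_subgroup S.
apply: span_min => [|_ [x Sx <-]]; last by exists x => //; apply: sub_group_span.
split; first by exists 1; rewrite ?morph1.
  by move=> _ _ [x Sx <-] [y Sy <-]; exists (x * y); rewrite ?pM //; apply: SM.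
by move=> _ [x Sx <-]; exists x^-1; rewrite ?morphV //; apply: SV.
Qed.

Lemma image_comm (H K : set G) :
  p @` comm_subgroup H K = comm_subgroup (p @` H) (p @` K).
Proof.
rewrite /comm_subgroup image_span; congr group_span; apply/seteqP; split.
  move=> _ [_ [x Hx [y Ky <-]] <-]; rewrite morph_comm.
  by exists (p x); [exists x | exists (p y); [exists y|]].
move=> _ [_ [x Hx <-] [_ [y Ky <-] <-]]; rewrite -morph_comm.
by exists (comm_elt x y) => //; exists x => //; exists y.
Qed.

Lemma image_normal_closure (K S : set G) :
  p @` normal_closure K S = normal_closure (p @` K) (p @` S).
Proof.
rewrite /normal_closure image_span; congr group_span; apply/seteqP; split.
  move=> _ [_ [x Hx [y Ky <-]] <-]; rewrite !pM morphV.
  by exists (p x); [exists x | exists (p y); [exists y|]].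
move=> _ [_ [x Hx <-] [_ [y Ky <-] <-]]; rewrite -morphV -!pM.
by exists (x * y * x^-1) => //; exists x => //; exists y.
Qed.

End Preimage.

Section Quotient.
Local Open Scope classical_set_scope.
Local Open Scope group_scope.
Local Open Scope quotient_scope.
Variables (G : groupType) (N : set G).
Hypothesis nN : normal N.

Definition coset_rel (x y : G) : bool := `[< N (x^-1 * y) >].

Lemma coset_rel_refl : reflexive coset_rel.
Proof. by move=> x; apply/asboolP; rewrite mulVg; case: nN => -[]. Qed.

Lemma coset_rel_sym : symmetric coset_rel.
Proof.
case: nN => -[_ _ NV] _.
by move=> x y; apply/asboolP/asboolP => /NV; rewrite invgM invgK.
Qed.

Lemma coset_rel_trans : transitive coset_rel.
Proof.
case: nN => -[_ NM _] _ y x z => /asboolP xy /asboolP yz; apply/asboolP.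
by have := NM _ _ xy yz; rewrite mulgA mulgK.
Qed.

Canonical coset_equiv := EquivRel coset_rel coset_rel_refl coset_rel_sym coset_rel_trans.

(** Working modulo a normal subgroup turns inclusions between commutator
    subgroups into statements that elements commute. *)
Definition quotient_type : Type := {eq_quot coset_equiv}.
HB.instance Definition _ := Choice.on quotient_type.
HB.instance Definition _ := EqQuotient.on quotient_type.

Let q (x : G) : quotient_type := \pi_quotient_type x.

Let qP x y : reflect (N (x^-1 * y)) (q x == q y).
Proof.
apply: (iffP idP); rewrite /q; first by rewrite eqmodE => /asboolP.
by move=> h; rewrite eqmodE; apply/asboolP.
Qed.

Let qE x y : N (x^-1 * y) -> q x = q y.
Proof. by move=> /qP/eqP. Qed.

Let qr (u : quotient_type) : q (repr u) = u.
Proof. exact: reprK. Qed.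

Definition quo_one : quotient_type := q 1.
Definition quo_mul (u v : quotient_type) : quotient_type := q (repr u * repr v).
Definition quo_inv (u : quotient_type) : quotient_type := q (repr u)^-1.

Let qM x y : quo_mul (q x) (q y) = q (x * y).
Proof.
case: nN => -[N1 NM NV] NC; apply: qE; set x' := repr (q x); set y' := repr (q y).
have /eqP/qP nx : q x' = q x by exact: qr.
have /eqP/qP ny : q y' = q y by exact: qr.
have := NM _ _ (NC y'^-1 _ nx) ny.
by rewrite !invgM !mulgA !invgK mulgK.
Qed.

Let qV x : quo_inv (q x) = q x^-1.
Proof.
case: nN => -[N1 NM NV] NC; apply: qE; set x' := repr (q x).
have /eqP/qP nx : q x = q x' by rewrite /x' qr.
by have := NC x _ nx; rewrite mulgA mulgV mul1g invgK.
Qed.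

Let quo_mulA : associative quo_mul.
Proof. by move=> u v w; rewrite -(qr u) -(qr v) -(qr w) !qM mulgA. Qed.
Let quo_mul1 : left_id quo_one quo_mul.
Proof. by move=> u; rewrite -(qr u) qM mul1g. Qed.
Let quo_mulr1 : right_id quo_one quo_mul.
Proof. by move=> u; rewrite -(qr u) qM mulg1. Qed.
Let quo_mulV : left_inverse quo_one quo_inv quo_mul.
Proof. by move=> u; rewrite -(qr u) qV qM mulVg. Qed.
Let quo_mulrV : right_inverse quo_one quo_inv quo_mul.
Proof. by move=> u; rewrite -(qr u) qV qM mulgV. Qed.

HB.instance Definition _ := isGroup.Build quotient_type
  quo_mulA quo_mul1 quo_mulr1 quo_mulV quo_mulrV.

Definition quo (x : G) : quotient_type := q x.

Lemma quoM : {morph quo : x y / x * y}.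
Proof. by move=> x y; rewrite /quo -qM. Qed.

Lemma quo_ker x : quo x = 1 <-> N x.
Proof.
split=> [e|Nx]; last first.
  rewrite -(morph1 quoM); apply: qE; rewrite mulg1.
  by case: nN => -[_ _ NV] _; apply: NV.
have : quo 1 = quo x by rewrite (morph1 quoM).
by move=> /eqP/qP; rewrite invg1 mul1g.
Qed.

End Quotient.

Section QuotientExists.
Local Open Scope classical_set_scope.
Local Open Scope group_scope.

Lemma quotient_exists (G : groupType) (N : set G) : normal N ->
  exists (Q : groupType) (p : G -> Q), {morph p : x y / x * y} /\ forall x, p x = 1 <-> N x.
Proof. by move=> nN; exists (quotient_type nN), (@quo _ _ nN); split=> [|x]; [apply: quoM | apply: quo_ker]. Qed.

End QuotientExists.

Section SubgroupType.
Local Open Scope classical_set_scope.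
Local Open Scope group_scope.
Variables (G : groupType) (H : set G).
Hypothesis sH : subgroup H.

Definition subgroup_type : Type := {g : G | `[< H g >]}.
HB.instance Definition _ := Choice.on subgroup_type.

Let sval_in (u : subgroup_type) : H (val u).
Proof. by apply/asboolP; exact: (valP u). Qed.

Let mk (g : G) (Hg : H g) : subgroup_type := exist _ g (introT (asboolP _) Hg).

Let sub_one : subgroup_type := mk (let: And3 h _ _ := sH in h).
Let sub_mul (u v : subgroup_type) : subgroup_type :=
  mk (let: And3 _ h _ := sH in h _ _ (sval_in u) (sval_in v)).
Let sub_inv (u : subgroup_type) : subgroup_type :=
  mk (let: And3 _ _ h := sH in h _ (sval_in u)).

Let sub_mulA : associative sub_mul.
Proof. by move=> u v w; apply: val_inj; rewrite /= mulgA. Qed.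
Let sub_mul1 : left_id sub_one sub_mul.
Proof. by move=> u; apply: val_inj; rewrite /= mul1g. Qed.
Let sub_mulr1 : right_id sub_one sub_mul.
Proof. by move=> u; apply: val_inj; rewrite /= mulg1. Qed.
Let sub_mulV : left_inverse sub_one sub_inv sub_mul.
Proof. by move=> u; apply: val_inj; rewrite /= mulVg. Qed.
Let sub_mulrV : right_inverse sub_one sub_inv sub_mul.
Proof. by move=> u; apply: val_inj; rewrite /= mulgV. Qed.

HB.instance Definition _ := isGroup.Build subgroup_type
  sub_mulA sub_mul1 sub_mulr1 sub_mulV sub_mulrV.

(** Passing to the elementary group as a group of its own makes the relative
    elementary subgroups normal in the whole group. *)
Lemma subgroup_exists : exists (E : groupType) (v : E -> G) (u : G -> E),
  [/\ {morph v : x y / x * y}, injective v, forall x, H (v x)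
    & forall g, H g -> v (u g) = g].
Proof.
exists subgroup_type, (fun x => val x),
  (fun g => if pselect (H g) is left h then mk h else 1); split=> //.
- exact: val_inj.
- by move=> g Hg; case: pselect.
Qed.

End SubgroupType.

(** * Unitary Steinberg relations and root subgroups *)

Section UnitaryRelations.
Local Open Scope group_scope.

(** The condition for [(i, j)] to be a short root. *)
Definition apart (I : eqType) (neg : I -> I) (i j : I) : bool :=
  (i != j) && (i != neg j).

(** The generators [t i j a] stand for the short and [l i g] for the long
    elementary unitary transvections.  The central units [c i], equal to the
    form constant or to one, absorb the powers of that constant which depend on
    the signs of the indices: [l i g] has the matrix entry [bar (c i) * g], so
    that its parameter is in [Lambda F] for positive and for negative [i]. *)
Record unitary_relations (A : pzRingType) (F : formRing A) (I : eqType)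
  (neg : I -> I) (c : I -> A) (G : groupType) (t : I -> I -> A -> G)
  (l : I -> A -> G) : Prop := {
  negK : forall i, neg (neg i) = i;
  neg_neq : forall i, neg i != i;
  third_index : forall i j, exists h, apart neg h i && apart neg h j;
  c_central : forall i a, (c i * a = a * c i)%R;
  c_unit : forall i, (c i * bar F (c i) = 1)%R;
  c_neg : forall i, (c i * c (neg i) = lam F)%R;
  rel_flip : forall i j a, apart neg i j ->
    t i j a = t (neg j) (neg i) (- (c j * bar F (c i) * bar F a))%R;
  rel_add : forall i j a b, apart neg i j ->
    t i j (a + b)%R = t i j a * t i j b;
  rel_ladd : forall i a b, Lambda F a -> Lambda F b ->
    l i (a + b)%R = l i a * l i b;
  rel_comm : forall i j k h a b, apart neg i j -> apart neg k h ->
    j != k -> i != h -> i != neg k -> j != neg h ->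
    commute (t i j a) (t k h b);
  rel_mul : forall i j h a b,
    apart neg i j -> apart neg j h -> apart neg i h ->
    comm_elt (t i j a) (t j h b) = t i h (a * b)%R;
  rel_long : forall i j a b, apart neg i j ->
    comm_elt (t i j a) (t j (neg i) b) =
    l i (c i * a * b - lam F * bar F (c i * a * b))%R;
  rel_tl : forall i j a g, apart neg i j -> Lambda F g ->
    comm_elt (t i j a) (l j g) =
    t i (neg j) (bar F (c j) * a * g)%R * l i (a * g * bar F a)%R;
  rel_ll : forall i k g d, i != neg k -> Lambda F g -> Lambda F d ->
    commute (l i g) (l k d);
  rel_tlC : forall k h j a g, apart neg k h -> h != j -> k != neg j ->
    Lambda F g -> commute (t k h a) (l j g)
}.

End UnitaryRelations.

Section UnitarySteinberg.
Local Open Scope classical_set_scope.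
Local Open Scope group_scope.
Variables (A : pzRingType) (F : formRing A) (I : eqType).
Variables (neg : I -> I) (c : I -> A) (G : groupType).
Variables (t : I -> I -> A -> G) (l : I -> A -> G).
Hypothesis St : unitary_relations F neg c t l.

Notation ap := (apart neg).
Notation bar := (bar F).
Notation lam := (lam F).
Notation Lam := (Lambda F).
Notation "P ** Q" := (form_prod F P Q) (at level 40, left associativity).
Notation top := (top_ideal F).
Notation ideal := (is_form_ideal F).
Implicit Types (i j k h m p : I) (a b : A) (P Q R : set A * set A).

Let nK := negK St.
Let topI := top_ideal_form F.

Section RootElements.
Implicit Types (x y z : G).

Lemma neg_inj : injective neg. Proof. exact: can_inj (negK St). Qed.

Lemma eq_negC i j : (neg i == j) = (i == neg j).
Proof. by rewrite -(inj_eq neg_inj) nK. Qed.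

Lemma apC i j : ap i j = ap j i.
Proof. by rewrite /apart eq_sym -eq_negC [neg i == j]eq_sym. Qed.

Lemma apNl i j : ap (neg i) j = ap i j.
Proof. by rewrite /apart !eq_negC nK andbC. Qed.

Lemma apNr i j : ap i (neg j) = ap i j.
Proof. by rewrite apC apNl apC. Qed.

Definition apE := (apNl, apNr).

Lemma ap_neq i j : ap i j -> i != j. Proof. by case/andP. Qed.
Lemma ap_neqN i j : ap i j -> i != neg j. Proof. by case/andP. Qed.

Lemma ap_irr i : ap i i = false. Proof. by rewrite /apart eqxx. Qed.

(** The root subgroup of level [P]; the ideal governs the short roots and the
    relative form parameter the long ones. *)
Definition root_set i j P : set G :=
  if j == neg i then [set l i g | g in P.2] else [set t i j a | a in P.1].

Definition root_gens P : set G :=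
  [set x | exists i j, i != j /\ root_set i j P x].

Definition rel_FU P : set G := group_span (root_gens P).
Definition rel_EU P : set G := normal_closure [set: G] (rel_FU P).

Definition odd_height (f : I -> int) := forall i, f (neg i) = (- f i)%R.

(** The product of the root subgroups of positive height, as in the unipotent
    radical of the parabolic subgroup that [f] determines. *)
Definition unip_rad (f : I -> int) P : set G :=
  group_span [set x | exists i j, [/\ i != j, (f j < f i)%R & root_set i j P x]].

Lemma root_short i j P : ap i j -> root_set i j P = [set t i j a | a in P.1].
Proof.
by rewrite apC => /andP[_ /negbTE ij]; rewrite /root_set ij.
Qed.

Lemma root_long i P : root_set i (neg i) P = [set l i g | g in P.2].
Proof. by rewrite /root_set eqxx. Qed.

Lemma root_cases i j : i != j -> ap i j \/ j = neg i.
Proof.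
move=> ij; case: (eqVneq j (neg i)) => [|jn]; [by right|left].
by rewrite /apart ij eq_sym eq_negC eq_sym eq_negC eq_sym in jn *; rewrite jn.
Qed.

Lemma mem_short i j P a : ap i j -> P.1 a -> root_set i j P (t i j a).
Proof. by move=> ij Pa; rewrite root_short //; exists a. Qed.

Lemma mem_long i P g : P.2 g -> root_set i (neg i) P (l i g).
Proof. by move=> Pg; rewrite root_long; exists g. Qed.

Lemma root_mono i j P Q : P.1 `<=` Q.1 -> P.2 `<=` Q.2 ->
  root_set i j P `<=` root_set i j Q.
Proof.
move=> s1 s2; rewrite /root_set; case: ifP => _ _ [a Pa <-]; exists a => //.
  exact: s2.
exact: s1.
Qed.

Lemma short0 i j : ap i j -> t i j 0 = 1.
Proof.
by move=> ij; apply: (mulgI (t i j 0)); rewrite -(rel_add St) // addr0 mulg1.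
Qed.

Lemma shortN i j a : ap i j -> t i j (- a)%R = (t i j a)^-1.
Proof.
by move=> ij; apply: (mulgI (t i j a)); rewrite -(rel_add St) // subrr short0 // mulgV.
Qed.

Lemma long0 i : l i 0 = 1.
Proof.
have z := zmod0 (Lambda_subgroup F).
by apply: (mulgI (l i 0)); rewrite -(rel_ladd St) // addr0 mulg1.
Qed.

Lemma longN i a : Lam a -> l i (- a)%R = (l i a)^-1.
Proof.
move=> La; have z := zmodN (Lambda_subgroup F) La.
by apply: (mulgI (l i a)); rewrite -(rel_ladd St) // subrr long0 // mulgV.
Qed.

Lemma bar_c i : (bar (c i) * c i = 1)%R.
Proof. by rewrite -(c_central St) (c_unit St). Qed.

Lemma barc_central i a : (bar (c i) * a = a * bar (c i))%R.
Proof. by rewrite -[a](barK F) -!barM (c_central St). Qed.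

Lemma c_negE i : (c (neg i) = bar (c i) * lam)%R.
Proof. by rewrite -(c_neg St i) mulrA bar_c mul1r. Qed.

(** The two names of a short root give the same subgroup because ideals are
    stable under the involution. *)
Lemma root_flip i j P : ideal P -> i != j ->
  root_set i j P = root_set (neg j) (neg i) P.
Proof.
move=> hP /root_cases[ij|->]; last by rewrite nK.
have ij' : ap (neg j) (neg i) by rewrite !apE apC.
rewrite !root_short //; apply/seteqP; split.
  move=> _ [a Pa <-]; rewrite (rel_flip St) //; eexists; last by [].
  by apply: (zmodN (ideal_zmod hP)); apply: (ideal_mull hP); apply: (ideal_bar hP).
move=> _ [a Pa <-]; rewrite (rel_flip St) // !nK; eexists; last by [].
by apply: (zmodN (ideal_zmod hP)); apply: (ideal_mull hP); apply: (ideal_bar hP).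
Qed.

Lemma root_subgroup i j P : ideal P -> i != j -> subgroup (root_set i j P).
Proof.
move=> hP /root_cases[ij|->].
  rewrite root_short //; have z := ideal_zmod hP.
  split; first by exists 0%R; [exact: zmod0| exact: short0].
    move=> _ _ [a Pa <-] [b Pb <-]; rewrite -(rel_add St) //.
    by exists (a + b)%R => //; apply: zmodD.
  by move=> _ [a Pa <-]; rewrite -shortN //; exists (- a)%R => //; apply: zmodN.
rewrite root_long; have z := param_zmod hP; have pL := param_Lambda hP.
split; first by exists 0%R; [exact: zmod0| exact: long0].
  move=> _ _ [a Pa <-] [b Pb <-]; rewrite -(rel_ladd St); [|exact: pL..].
  by exists (a + b)%R => //; apply: zmodD.
by move=> _ [a Pa <-]; rewrite -longN; [exists (- a)%R => //; apply: zmodN|exact: pL].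
Qed.

Lemma rel_FU_root i j P : i != j -> root_set i j P `<=` rel_FU P.
Proof. by move=> ij x Xx; apply: (@sub_group_span _ (root_gens P)); exists i, j. Qed.

Lemma rel_FU_EU P : rel_FU P `<=` rel_EU P.
Proof.
by move=> x Fx; rewrite /rel_EU /normal_closure; apply: sub_group_span; exists 1 => //; exists x => //; rewrite mul1g invg1 mulg1.
Qed.

Lemma rel_EU_root i j P : i != j -> root_set i j P `<=` rel_EU P.
Proof. by move=> ij x Xx; apply: rel_FU_EU; apply: rel_FU_root Xx. Qed.

Lemma rel_EU_normal P : normal (rel_EU P).
Proof.
apply: span_normal => g _ [x _ [y Fy <-]]; exists (g * x) => //.
by exists y => //; rewrite invgM !mulgA.
Qed.

Lemma rel_EU_min P N : normal N ->
  (forall i j, i != j -> root_set i j P `<=` N) -> rel_EU P `<=` N.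
Proof.
move=> [sN nN] H; apply: (span_min sN) => _ [x _ [y Fy <-]]; apply: nN.
by apply: (span_min sN) Fy => z [i [j [ij Xz]]]; apply: H Xz.
Qed.

Lemma unip_rad_root f i j P : i != j -> (f j < f i)%R -> root_set i j P `<=` unip_rad f P.
Proof. by move=> ij fij x Xx; rewrite /unip_rad; apply: sub_group_span; exists i, j. Qed.

Lemma unip_rad_FU f P : unip_rad f P `<=` rel_FU P.
Proof.
by apply: span_mono => x [i [j [ij _ Xx]]]; exists i, j.
Qed.

Lemma unip_rad_mono f P Q : P.1 `<=` Q.1 -> P.2 `<=` Q.2 -> unip_rad f P `<=` unip_rad f Q.
Proof.
move=> s1 s2; apply: span_mono => x [i [j [ij fij Xx]]]; exists i, j; split=> //.
by apply: root_mono Xx.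
Qed.

Lemma unip_rad_subgroup f P : subgroup (unip_rad f P).
Proof. exact: span_subgroup. Qed.

Lemma unip_radV f P x : unip_rad f P x -> unip_rad f P x^-1.
Proof. by case: (unip_rad_subgroup f P) => _ _; apply. Qed.

Section Chevalley.
Variables (f : I -> int) (fN : odd_height f).

(** Every nontrivial commutator of short root elements is of this form, up to
    renaming roots and exchanging the two factors. *)
Lemma chevalley_chain i j k a b P Q : ideal P -> ideal Q ->
  ap i j -> ap j k -> k != i -> (f k < f i)%R -> P.1 a -> Q.1 b ->
  unip_rad f (P ** Q) (comm_elt (t i j a) (t j k b)).
Proof.
move=> hP hQ ij jk ki fki Pa Qb; have hPQ := form_prod_form hP hQ.
rewrite eq_sym in ki; case: (root_cases ki) => [ik|e].
  rewrite (rel_mul St) //; apply: (unip_rad_root ki fki).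
  by apply: mem_short => //; apply: form_prod_mull.
subst k; rewrite (rel_long St) //; apply: (unip_rad_root ki fki).
apply: mem_long; apply: (param_min hPQ); rewrite -mulrA.
by apply: (ideal_mull hPQ); apply: form_prod_mull.
Qed.

Lemma chevalley_short_short i j k h P Q x y : ideal P -> ideal Q ->
  ap i j -> ap k h -> (f j <= f i)%R -> (f h <= f k)%R ->
  (f j + f h < f i + f k)%R -> root_set i j P x -> root_set k h Q y ->
  unip_rad f (P ** Q) (comm_elt x y).
Proof.
move=> hP hQ ij kh fij fkh fs.
have fi := fN i; have fj := fN j; have fk := fN k; have fh := fN h.
rewrite root_short // => -[a Pa <-{x}].
have link k' h' b' : k' = j -> ap k' h' -> h' != i -> (f h' <= f k')%R ->
    (f h' < f i)%R -> Q.1 b' -> unip_rad f (P ** Q) (comm_elt (t i j a) (t k' h' b')).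
  by move=> e kh' hi' fkh' fhi' Qb; subst k'; apply: chevalley_chain.
have link' k' h' b' : h' = i -> ap k' h' -> k' != j -> (f h' <= f k')%R ->
    (f j < f k')%R -> Q.1 b' -> unip_rad f (P ** Q) (comm_elt (t i j a) (t k' h' b')).
  move=> e kh' kj fkh' fjk Qb; subst h'; rewrite -comm_eltV form_prodC.
  by apply: unip_radV; apply: chevalley_chain => //; rewrite eq_sym.
case: (eqVneq j k) => [e|jk].
  rewrite root_short // => -[b Qb <-]; apply: link => //.
    by apply/eqP => e'; subst; lia.
  by subst; lia.
case: (eqVneq i h) => [e|ih].
  rewrite root_short // => -[b Qb <-]; apply: link' => //.
    by rewrite eq_sym.
  by subst; lia.
rewrite root_flip ?(ap_neq kh) //.
have kh' : ap (neg h) (neg k) by rewrite !apE apC.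
case: (eqVneq i (neg k)) => [e|ik].
  rewrite root_short // => -[b Qb <-]; apply: link' => //.
  - by apply/eqP => e'; subst; lia.
  - by rewrite fh fk; lia.
  - by subst; lia.
case: (eqVneq j (neg h)) => [e|jh].
  rewrite root_short // => -[b Qb <-]; apply: link => //.
  - by rewrite eq_sym.
  - by rewrite fh fk; lia.
  - by subst; lia.
rewrite -root_flip ?(ap_neq kh) // root_short // => -[b Qb <-].
rewrite (_ : comm_elt _ _ = 1); last exact/comm_elt1P/(rel_comm St).
by case: (unip_rad_subgroup f (P ** Q)).
Qed.

Lemma chevalley_short_long i j k P Q x y : ideal P -> ideal Q ->
  ap i j -> (f j <= f i)%R -> (f (neg k) <= f k)%R ->
  (f j + f (neg k) < f i + f k)%R -> root_set i j P x -> root_set k (neg k) Q y ->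
  unip_rad f (P ** Q) (comm_elt x y).
Proof.
move=> hP hQ ij fij fk fs.
have Ni := fN i; have Nj := fN j; have Nk := fN k.
rewrite root_long => Xx [g Qg <-{y}].
have [u1 uM uV] := unip_rad_subgroup f (P ** Q).
have Lg := param_Lambda hQ Qg.
have link i' a : ap i' k -> (0 < f i' + f k)%R -> (f k <= f i')%R -> P.1 a ->
    unip_rad f (P ** Q) (comm_elt (t i' k a) (l k g)).
  move=> ik f0 fki Pa; rewrite (rel_tl St) //; apply: uM.
    apply: (@unip_rad_root _ i' (neg k)); [by rewrite ap_neqN|by lia|].
    apply: mem_short; rewrite ?apE // -mulrA.
    apply: (ideal_mull (form_prod_form hP hQ)); apply: form_prod_mull => //.
    exact: (param_ideal hQ).
  apply: (@unip_rad_root _ i' (neg i')).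
  + by rewrite eq_sym (neg_neq St).
  + by rewrite fN; lia.
  + by apply: mem_long; apply: form_prod_sandwichl.
case: (eqVneq j k) => [e|jk].
  subst k; move: Xx; rewrite root_short // => -[a Pa <-]; apply: link => //; lia.
case: (eqVneq i (neg k)) => [e|ik].
  move: Xx; rewrite root_flip ?(ap_neq ij) //.
  have -> : neg i = k by rewrite e nK.
  have jk' : ap (neg j) k by rewrite -(nK k) -e !apE apC.
  rewrite root_short // => -[a Pa <-]; apply: link => //; subst; lia.
move: Xx; rewrite root_short // => -[a Pa <-].
rewrite (_ : comm_elt _ _ = 1) //; apply/comm_elt1P/(rel_tlC St) => //.
Qed.

(** The commutator is a product of root elements for sums of positive multiples
    of the two roots, all of which have positive height.  The hypothesis on
    heights allows one of the roots to have height zero, and excludes opposite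
    roots. *)
Lemma chevalley i j k h P Q x y : ideal P -> ideal Q ->
  i != j -> k != h -> (f j <= f i)%R -> (f h <= f k)%R ->
  (f j + f h < f i + f k)%R -> root_set i j P x -> root_set k h Q y ->
  unip_rad f (P ** Q) (comm_elt x y).
Proof.
move=> hP hQ /root_cases[ij|ej] /root_cases[kh|ek] fij fkh fs Xx Yy.
- by apply: chevalley_short_short Xx Yy.
- by subst h; apply: chevalley_short_long Xx Yy.
- subst j; rewrite form_prodC -comm_eltV; apply: unip_radV.
  by apply: chevalley_short_long Yy Xx => //; lia.
subst j h; move: Xx Yy; rewrite !root_long => -[g Pg <-] [d Qd <-].
rewrite (_ : comm_elt _ _ = 1).
  by case: (unip_rad_subgroup f (P ** Q)).
apply/comm_elt1P/(rel_ll St); [|exact: (param_Lambda hP)|exact: (param_Lambda hQ)].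
by apply/eqP=> e; subst; have := (fN k); rewrite !nK in fij fs *; lia.
Qed.

End Chevalley.

End RootElements.

(** * Height functions and unipotent radicals *)

Notation X := root_set.
Notation V := unip_rad.

Section Heights.
Implicit Types (x y z : G).

Definition delta_height k i : int := ((i == k)%:Z - (i == neg k)%:Z)%R.

Lemma delta_height_odd k : odd_height (delta_height k).
Proof.
by move=> i; rewrite /delta_height eq_negC (inj_eq neg_inj) opprB.
Qed.

Lemma delta_height_id k : delta_height k k = 1%R.
Proof.
by rewrite /delta_height eqxx eq_sym (negbTE (neg_neq St k)) subr0.
Qed.

Lemma delta_height_apart k i : ap i k -> delta_height k i = 0%R.
Proof. by case/andP=> /negbTE ik /negbTE ik'; rewrite /delta_height ik ik'. Qed.

Definition same_root i j k h : bool :=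
  ((k == i) && (h == j)) || ((k == neg j) && (h == neg i)).

Definition parallel i j k h := same_root i j k h || same_root j i k h.

(** Roots that are not proportional are separated by a linear function that
    vanishes on the first one. *)
Lemma exists_height i j k h : i != j -> k != h -> ~~ parallel i j k h ->
  exists2 f, odd_height f & f i = f j /\ (f h < f k)%R.
Proof.
move=> ij kh np.
have d_le (m p : I) : (delta_height p m <= 1)%R /\ (m != p -> delta_height p m <= 0)%R.
  by rewrite /delta_height; do 2 case: eqP.
(* If [k] differs from [i], [-i], [j] and [-j], a height supported on [k] and
   [-k] works; similarly for [h].  Otherwise both roots lie in the span of [i]
   and [j], and the sum of the two coordinates decides. *)
have [kap|] := boolP (ap k i && ap k j).
  case/andP: kap; rewrite ![ap k _]apC => ki kj.
  exists (delta_height k); first exact: delta_height_odd.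
  rewrite (delta_height_apart ki) (delta_height_apart kj) delta_height_id; split=> //.
  by rewrite eq_sym in kh; have [_ /(_ kh)] := d_le h k; lia.
have [hap|] := boolP (ap h i && ap h j).
  case/andP: hap; rewrite ![ap h _]apC => hi hj _.
  exists (fun m => - delta_height h m)%R; first by move=> m; rewrite delta_height_odd.
  rewrite (delta_height_apart hi) (delta_height_apart hj) delta_height_id; split=> //.
  by have [_ /(_ kh)] := d_le k h; lia.
have inP m : ~~ (ap m i && ap m j) -> [|| m == i, m == neg i, m == j | m == neg j].
  by rewrite /apart; do 4 case: eqP.
move=> /inP hP /inP kP.
case: (root_cases ij) => [apij|e]; last first.
  move: np kh; rewrite /parallel /same_root.
  by case/or4P: hP => /eqP ->; case/or4P: kP => /eqP ->; rewrite e ?nK ?eqxx ?orbT //= ?andbT ?orbT.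
have fi := delta_height_id i; have fj := delta_height_id j.
have fij := delta_height_apart apij.
have fji : delta_height i j = 0%R.
  by apply: delta_height_apart; rewrite apC.
pose f (m : I) := (delta_height i m + delta_height j m)%R.
have fo : odd_height f by move=> a; rewrite /f !delta_height_odd; lia.
have f1 : f i = 1%R by rewrite /f fi fij addr0.
have f2 : f j = 1%R by rewrite /f fj fji add0r.
have f3 : f (neg i) = (-1)%R by rewrite fo f1.
have f4 : f (neg j) = (-1)%R by rewrite fo f2.
have [lt|] := boolP (f h < f k)%R; first by exists f => //; split=> //; rewrite f1 f2.
have [lt _|] := boolP (f k < f h)%R.
  exists (fun m => - f m)%R; first by move=> m; rewrite fo.
  by split; [rewrite f1 f2 | lia].
case/or4P: hP kP np kh => /eqP ->; case/or4P => /eqP ->;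
  rewrite /parallel /same_root ?eqxx ?f1 ?f2 ?f3 ?f4 ?orbT //= ?andbT ?orbT //.
Qed.

Lemma same_root_opp i j k h : same_root j i k h = same_root h k i j.
Proof.
rewrite /same_root [i == h]eq_sym [j == k]eq_sym [i == neg k]eq_sym.
by rewrite [j == neg h]eq_sym !eq_negC andbC [(k == _) && (h == neg _)]andbC.
Qed.

Lemma same_root_height f i j k h : odd_height f -> same_root i j k h ->
  (f k - f h = f i - f j)%R.
Proof.
by move=> fo /orP[] /andP[/eqP -> /eqP ->] //; rewrite !fo opprK addrC.
Qed.

Lemma same_rootE i j k h P : ideal P -> i != j -> same_root i j k h ->
  X k h P = X i j P.
Proof.
by move=> hP ij /orP[] /andP[/eqP -> /eqP ->] //; rewrite -root_flip.
Qed.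

Lemma exists_height1 i j : i != j -> exists2 f, odd_height f & (f j < f i)%R.
Proof.
move=> ij; exists (delta_height i); first exact: delta_height_odd.
by rewrite delta_height_id /delta_height eq_sym (negbTE ij); case: eqP.
Qed.

Lemma chevalley_FU i j k h P Q x y : ideal P -> ideal Q -> i != j -> k != h ->
  ~~ same_root j i k h -> X i j P x -> X k h Q y -> rel_FU (P ** Q) (comm_elt x y).
Proof.
move=> hP hQ ij kh no Xx Yy.
have [s|ns] := boolP (same_root i j k h).
  have [f fo fij] := exists_height1 ij; apply: (@unip_rad_FU f).
  have e := same_root_height fo s.
  by apply: (chevalley fo hP hQ ij kh) => //; lia.
have [|f fo [fij fkh]] := exists_height ij kh; first by rewrite /parallel negb_or ns.
apply: (@unip_rad_FU f).
by apply: (chevalley fo hP hQ ij kh) => //; lia.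
Qed.

Lemma rootV i j P x : ideal P -> i != j -> X i j P x -> X i j P x^-1.
Proof. by move=> hP ij; have [_ _] := root_subgroup hP ij; apply. Qed.

Lemma root_abelian i j P x y : ideal P -> i != j ->
  X i j P x -> X i j P y -> commute x y.
Proof.
move=> hP /root_cases[ij|->].
  rewrite !root_short // => -[a _ <-] [b _ <-]; apply: (rel_comm St) => //.
  - by rewrite eq_sym (ap_neq ij).
  - exact: ap_neq ij.
  - by rewrite eq_sym (neg_neq St).
  - by rewrite eq_sym (neg_neq St).
rewrite !root_long => -[a Pa <-] [b Pb <-]; apply: (rel_ll St).
- by rewrite eq_sym (neg_neq St).
- exact: (param_Lambda hP).
- exact: (param_Lambda hP).
Qed.

Lemma unip_rad_top f P : ideal P -> V f (P ** top) `<=` V f P.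
Proof. by move=> hP; have [s1 s2] := form_prod_top_sub hP; apply: unip_rad_mono. Qed.

Lemma rel_FU_top P : ideal P -> rel_FU (P ** top) `<=` rel_FU P.
Proof.
move=> hP; have [s1 s2] := form_prod_top_sub hP.
apply: span_mono => x [i [j [ij Xx]]]; exists i, j; split=> //.
by apply: root_mono Xx.
Qed.

Lemma root_top i j P : ideal P -> i != j -> X i j P `<=` X i j top.
Proof.
by move=> hP ij; apply: root_mono => // x; apply: (param_Lambda hP).
Qed.

Section Height.
Variables (f : I -> int) (fo : odd_height f).

Lemma unip_rad_conj P v w : ideal P -> V f top v -> V f P w -> V f P (v * w * v^-1).
Proof.
move=> hP; apply: span_normalizes.
  by move=> x [i [j [ij fij Xx]]]; exists i, j; split=> //; apply: rootV.
move=> x y [i [j [ij fij Xx]]]; apply: span_conj => z [k [h [kh fkh Zz]]].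
rewrite comm_elt_conj; have [_ M _] := unip_rad_subgroup f P.
apply: M; last by apply: unip_rad_root Zz.
apply: (unip_rad_top hP); rewrite form_prodC.
by apply: (chevalley fo) Xx Zz => //; lia.
Qed.

Lemma root_unip_rad_conj i j P x w : ideal P -> i != j -> f i = f j ->
  X i j top x -> V f P w -> V f P (x * w * x^-1).
Proof.
move=> hP ij fij Xx; apply: span_conj => z [k [h [kh fkh Zz]]].
rewrite comm_elt_conj; have [_ M _] := unip_rad_subgroup f P.
apply: M; last by apply: unip_rad_root Zz.
apply: (unip_rad_top hP); rewrite form_prodC.
by apply: (chevalley fo) Xx Zz => //; lia.
Qed.

Lemma unip_rad_ideal_top P : ideal P -> V f P `<=` V f top.
Proof. by move=> hP; apply: unip_rad_mono => // x; apply: (param_Lambda hP). Qed.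

Lemma root_unip_rad_comm i j P Q x v : ideal P -> ideal Q -> i != j -> f i = f j ->
  X i j P x -> V f Q v -> V f (P ** Q) (comm_elt x v).
Proof.
move=> hP hQ ij fij Xx; apply: comm_span_right.
- exact: unip_rad_subgroup.
- by move=> w u /(unip_rad_ideal_top hQ) Vw; apply: unip_rad_conj => //; apply: form_prod_form.
- by move=> w [k [h [kh fkh Ww]]]; apply: (chevalley fo) Xx Ww => //; lia.
Qed.

Lemma unip_rad_comm P Q w v : ideal P -> ideal Q ->
  V f P w -> V f Q v -> V f (P ** Q) (comm_elt w v).
Proof.
move=> hP hQ Ww Vv; move: Ww; apply: comm_span_left.
- exact: unip_rad_subgroup.
- by move=> x u /(unip_rad_ideal_top hP) Vw; apply: unip_rad_conj => //; apply: form_prod_form.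
move=> x [i [j [ij fij Xx]]]; move: Vv; apply: comm_span_right.
- exact: unip_rad_subgroup.
- by move=> y u /(unip_rad_ideal_top hQ) Vw; apply: unip_rad_conj => //; apply: form_prod_form.
- by move=> w' [k [h [kh fkh Ww]]]; apply: (chevalley fo) Xx Ww => //; lia.
Qed.

(** The radical is normalised by the Levi factor, which contains [x] and [y];
    hence conjugating an element of the Levi factor of level [P] by [v] changes
    it by an element of the radical of level [P]. *)
Lemma unip_rad_conj_z i j P v x y : ideal P -> i != j -> f i = f j ->
  V f top v -> X i j P x -> X j i top y ->
  exists2 w, V f P w & v * (y * x * y^-1) * v^-1 = w * (y * x * y^-1).
Proof.
move=> hP ij fij Vv Xx Yy; have ji : j != i by rewrite eq_sym.
pose v' := y^-1 * v * y.
have Vv' : V f top v'.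
  rewrite /v' -{2}[y]invgK; apply: (root_unip_rad_conj (i := j) (j := i)) => //.
  exact: rootV.
have Vw : V f P (comm_elt v' x).
  rewrite -comm_eltV; apply: unip_radV; apply: (unip_rad_top hP).
  by apply: (root_unip_rad_comm (i := i) (j := j)).
exists (y * comm_elt v' x * y^-1).
  by apply: (root_unip_rad_conj (i := j) (j := i)).
by rewrite /comm_elt /v' !invgM !invgK !mulgA !mulgVK !mulgK mulgV mul1g.
Qed.

End Height.

Lemma apart_not_parallel i j k h :
  (ap k i && ap k j) || (ap h i && ap h j) -> ~~ parallel i j k h.
Proof.
move=> H; apply/negP => /orP[]/orP[] /andP[/eqP ek /eqP eh]; move: H;
  by rewrite ek eh ?apNl ?ap_irr ?andbF ?andFb.
Qed.

(** Every root element is a combination of root elements for roots not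
    proportional to the given one.  This removes the cases in which two roots
    are proportional, where no height function is available.  The roots that
    occur are positive for a single height, so that no two of them are
    opposite. *)
Lemma split_root i j : i != j ->
  exists f i1 j1 i2 j2 i3 j3,
  [/\ odd_height f,
      [/\ i1 != j1, (f j1 < f i1)%R & ~~ parallel i j i1 j1],
      [/\ i2 != j2, (f j2 < f i2)%R & ~~ parallel i j i2 j2],
      [/\ i3 != j3, (f j3 < f i3)%R & ~~ parallel i j i3 j3]
    & forall P x, ideal P -> X i j P x -> exists x1 x2 x3,
      [/\ X i1 j1 P x1, X i2 j2 top x2, X i3 j3 P x3 & x = comm_elt x1 x2 * x3]].
Proof.
move=> /root_cases[ij|->{j}].
  have [h /andP[hi hj]] := third_index St i j.
  have ih : ap i h by rewrite apC.
  have ji : ap j i by rewrite apC.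
  pose f (m : I) := (delta_height i m - delta_height j m)%R.
  have fi : f i = 1%R by rewrite /f delta_height_id (delta_height_apart ij) subr0.
  have fj : f j = (-1)%R by rewrite /f delta_height_id (delta_height_apart ji) sub0r.
  have fh : f h = 0%R by rewrite /f (delta_height_apart hi) (delta_height_apart hj).
  have np1 : ~~ parallel i j i h by apply: apart_not_parallel; rewrite hi hj orbT.
  have np2 : ~~ parallel i j h j by apply: apart_not_parallel; rewrite hi hj.
  exists f, i, h, h, j, i, h; split.
  - by move=> a; rewrite /f !delta_height_odd; lia.
  - by split=> //; [exact: ap_neq ih| rewrite fi fh].
  - by split=> //; [exact: ap_neq hj| rewrite fj fh].
  - by split=> //; [exact: ap_neq ih| rewrite fi fh].
  move=> P x hP; rewrite root_short // => -[a Pa <-].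
  exists (t i h a), (t h j 1), 1; split.
  - exact: mem_short.
  - exact: mem_short.
  - by have [] := root_subgroup hP (ap_neq ih).
  - by rewrite (rel_mul St) // mulr1 mulg1.
have [j /andP[ji _]] := third_index St i i.
have ij : ap i j by rewrite apC.
pose f (m : I) := (delta_height i m + delta_height i m + delta_height j m)%R.
have fo : odd_height f by move=> a; rewrite /f !delta_height_odd; lia.
have fi : f i = 2%R by rewrite /f delta_height_id (delta_height_apart ij).
have fj : f j = 1%R by rewrite /f delta_height_id (delta_height_apart ji).
have np m p : ap m i || ap p i -> ~~ parallel i (neg i) m p.
  by move=> H; apply: apart_not_parallel; rewrite !apNr !andbb.
(* [[t_ij(1), l_j(g)]] equals [t_i,-j(bar (c j) * g) * l_i(g)]; solve this for
   [l_i(g)], with [-g] in place of [g] to keep the order of the factors. *)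
exists f, j, (neg j), i, j, i, (neg j); split=> //.
- split; first by rewrite eq_sym (neg_neq St).
    by rewrite fo fj.
  by apply: np; rewrite ji.
- split; [exact: ap_neq ij|by rewrite fi fj|].
  by apply: np; rewrite ji orbT.
- split; [exact: ap_neqN ij|by rewrite fo fi fj|].
  by apply: np; rewrite apNl ji orbT.
move=> P x hP; rewrite root_long // => -[g Pg <-].
have Lg := param_Lambda hP Pg; have LN := zmodN (Lambda_subgroup F) Lg.
exists (l j (- g)%R), (t i j 1), (t i (neg j) (bar (c j) * 1 * (- g))%R); split.
- by apply: mem_long; apply: (zmodN (param_zmod hP)).
- exact: mem_short.
- apply: mem_short; rewrite ?apNr //; apply: (ideal_mull hP).
  by apply: (zmodN (ideal_zmod hP)); apply: (param_ideal hP).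
rewrite -comm_eltV (rel_tl St) // invgM mulgVK mul1r bar1 mulr1.
by rewrite longN // invgK.
Qed.

End Heights.

(** * Mutual commutator subgroups *)

Hypothesis Gen : forall x, rel_FU top x.

Section MutualCommutators.
Implicit Types (x y z : G).

(** The conjugates [y * x * y^-1] of root elements by elements of the opposite
    root subgroup.  The set [S] restricts the roots for which such conjugates
    are admitted. *)
Definition z_gens (S : I -> I -> Prop) P : set G :=
  [set z | rel_FU P z \/ exists i j x y, [/\ i != j, S i j, X i j P x, X j i top y
     & z = y * x * y^-1]].

Notation Z S P := (group_span (z_gens S P)).

(** Conjugation by an element for the root [(k, h)] creates new conjugates only
    for the opposite root [(h, k)], provided that none are present for [(k, h)]
    itself. *)
Lemma z_gens_conj (S S' : I -> I -> Prop) P k h g z : ideal P -> k != h ->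
  (forall i j, S i j -> S' i j /\ ~~ same_root i j k h) ->
  (forall i j, i != j -> same_root j i k h -> S' i j) ->
  X k h top g -> Z S P z -> Z S' P (g * z * g^-1).
Proof.
move=> hP kh SS' opS' Xg; apply: span_conj => x.
have [_ ZM _] := span_subgroup (z_gens S' P).
have FZ w : rel_FU P w -> Z S' P w by move=> Fw; apply: sub_group_span; left.
case=> [Fx|[i [j [a [y [ij Sij Xa Yy ->]]]]]].
  move: Fx; apply: span_conj => {}x [i [j [ij Xx]]].
  have [s|ns] := boolP (same_root j i k h).
    apply: sub_group_span; right; exists i, j, x, g; split=> //; first exact: opS'.
    by rewrite -(same_rootE topI _ s) // eq_sym.
  rewrite comm_elt_conj; apply: ZM; apply: FZ; last exact: rel_FU_root Xx.
  apply: (rel_FU_top hP); rewrite form_prodC.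
  by apply: (chevalley_FU topI hP kh ij) => //; rewrite -same_root_opp.
have [S'ij ns] := SS' _ _ Sij; have ji : j != i by rewrite eq_sym.
have [s|no] := boolP (same_root j i k h).
  apply: sub_group_span; right; exists i, j, a, (g * y); split=> //.
    have [_ M _] := root_subgroup topI ji.
    by apply: (M) => //; rewrite -(same_rootE topI _ s).
  by rewrite invgM !mulgA.
have [|f fo [fij fkh]] := exists_height ij kh; first by rewrite /parallel negb_or ns.
have [w Vw ->] := unip_rad_conj_z fo hP ij fij (unip_rad_root kh fkh Xg) Xa Yy.
apply: ZM; first by apply: FZ; apply: unip_rad_FU Vw.
by apply: sub_group_span; right; exists i, j, a, y.
Qed.

(** The relative elementary group is generated by the [z_gens].  They are
    stable under conjugation by an element for a root other than their own, by
    [z_gens_conj]; an element for their own root is first split into factors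
    for other roots. *)
Lemma rel_EU_zgen P : ideal P -> rel_EU P `<=` Z (fun _ _ => True) P.
Proof.
move=> hP; set ZT := Z _ P.
have [_ ZM ZV] := span_subgroup (z_gens (fun _ _ => True) P).
have weaken S z : Z S P z -> ZT z.
  apply: span_mono => w [Fw|[i [j [x [y [ij _ Xx Yy ->]]]]]]; first by left.
  by right; exists i, j, x, y.
have nZ g z : ZT z -> ZT (g * z * g^-1).
  apply: span_normalizes (Gen g) => [x [i [j [ij Xx]]]|{}g w [k [h [kh Xg]]]].
    by exists i, j; split=> //; apply: (rootV topI ij).
  apply: span_conj => {}w.
  have base S x : z_gens S P x -> Z S P x by apply: sub_group_span.
  case=> [Fw|[i [j [x [y [ij _ Xx Yy ->]]]]]].
    have : Z (fun _ _ => False) P w by apply: base; left.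
    move=> /(@z_gens_conj _ (same_root h k) _ _ _ _ _ hP kh) H.
    apply: (@weaken (same_root h k)); apply: H => // i j ij.
    by rewrite same_root_opp.
  have [s|ns] := boolP (same_root i j k h); last first.
    have : Z (same_root i j) P (y * x * y^-1).
      by apply: base; right; exists i, j, x, y; split=> //; rewrite /same_root !eqxx.
    move=> /(@z_gens_conj _ (fun _ _ => True) _ _ _ _ _ hP kh) H.
    apply: H => // i' j' s; split=> //; apply: contra ns.
    by move: s => /orP[]/andP[/eqP -> /eqP ->] //;
      rewrite /same_root !nK orbC.
  have [f [i1 [j1 [i2 [j2 [i3 [j3 [fo [ij1 f1 p1] [ij2 f2 p2] [ij3 f3 p3] sp]]]]]]]] :=
    split_root ij.
  (* The conjugates present at each stage: those for the root [(i, j)] and for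
     the negative roots.  The factors in the splitting of [g] are positive and
     not proportional to [(i, j)], so that they keep this set stable. *)
  pose S m p := same_root i j m p \/ (f m < f p)%R.
  have step k' h' g' w' : k' != h' -> (f h' < f k')%R -> ~~ parallel i j k' h' ->
      X k' h' top g' -> Z S P w' -> Z S P (g' * w' * g'^-1).
    move=> kh' fkh' np; apply: z_gens_conj => //.
      move=> m p Smp; split=> //; apply/negP => s'; case: Smp => [smp|fmp].
        move: np; rewrite /parallel negb_or => /andP[/negP + _]; apply.
        by case/orP: smp s' => /andP[/eqP -> /eqP ->] //;
          rewrite /same_root !nK orbC.
      by have := same_root_height fo s'; lia.
    move=> m p mp s'; right; have := same_root_height fo s'; lia.
  have Xg' : X i j top g by rewrite -(same_rootE topI ij s).
  have [x1 [x2 [x3 [X1 X2 X3 ->]]]] := sp _ _ topI Xg'.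
  have step1 w' := step i1 j1 x1 w' ij1 f1 p1 X1.
  have step1' w' := step i1 j1 _ w' ij1 f1 p1 (rootV topI ij1 X1).
  have step2 w' := step i2 j2 x2 w' ij2 f2 p2 X2.
  have step2' w' := step i2 j2 _ w' ij2 f2 p2 (rootV topI ij2 X2).
  have step3 w' := step i3 j3 x3 w' ij3 f3 p3 X3.
  have : Z S P (y * x * y^-1).
    by apply: base; right; exists i, j, x, y; split=> //; left; rewrite /same_root !eqxx.
  move=> /step3/step2'/step1'/step2/step1/weaken.
  by rewrite /comm_elt !invgM !invgK !mulgA.
apply: rel_EU_min => [|i j ij x Xx].
  by split=> //; apply: span_subgroup.
by apply: sub_group_span; left; apply: rel_FU_root Xx.
Qed.

Section Mutual.
Variables (P Q : set A * set A).
Hypotheses (hP : ideal P) (hQ : ideal Q).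
Variable K : set G.
Hypotheses (nK' : normal K) (MK : rel_EU (P ** Q) `<=` K).
Hypothesis YK : forall i j x y, i != j -> X i j P x -> X j i Q y -> K (comm_elt x y).

Let K1 : K 1. Proof. by case: nK' => -[]. Qed.
Let KM x y : K x -> K y -> K (x * y).
Proof. by case: nK' => -[_ H _] _; apply: H. Qed.
Let KV x : K x -> K x^-1. Proof. by case: nK' => -[_ _ H] _; apply: H. Qed.
Let KC g x : K x -> K (g * x * g^-1). Proof. by case: nK' => _; apply. Qed.

Lemma rel_FU_comm x y : rel_FU P x -> rel_FU Q y -> K (comm_elt x y).
Proof.
have [Qt [p [pM pk]]] := quotient_exists nK'.
suff H : forall x y, root_gens P x -> root_gens Q y -> commute (p x) (p y).
  move=> Fx Fy; apply/pk; rewrite morph_comm //; apply/comm_elt1P.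
  by apply: (span_commute pM H).
move=> {}x {}y [i [j [ij Xx]]] [k [h [kh Yy]]].
apply/comm_elt1P; rewrite -morph_comm //; apply/pk.
have [s|no] := boolP (same_root j i k h).
  by apply: (YK ij Xx); rewrite -(same_rootE hQ _ s) // eq_sym.
apply: MK; apply: rel_FU_EU.
exact: (chevalley_FU hP hQ ij kh).
Qed.

(** For nonproportional roots, [y^-1] conjugates [u] into a unipotent radical
    whose Levi factor contains [x].  Opposite roots reduce to the hypothesis on
    SL2 commutators, and for equal roots [u] is split into factors for other
    roots. *)
Lemma root_z_comm k h u i j x y : k != h -> i != j ->
  X k h P u -> X i j Q x -> X j i top y -> K (comm_elt u (y * x * y^-1)).
Proof.
move=> kh ij Xa Xx Yy; have ji : j != i by rewrite eq_sym.
have nonpar k' h' u' : k' != h' -> ~~ parallel i j k' h' -> X k' h' P u' ->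
    K (comm_elt u' (y * x * y^-1)).
  move=> kh' np Xa'; have [f fo [fij fkh]] := exists_height ij kh' np.
  have -> : comm_elt u' (y * x * y^-1) =
      y * comm_elt (y^-1 * u' * y^-1^-1) x * y^-1.
    by rewrite comm_elt_mul invgK !mulgA mulgV mul1g mulgK.
  apply: KC; apply: MK; apply: rel_FU_EU; apply: (@unip_rad_FU f).
  rewrite -comm_eltV form_prodC; apply: unip_radV.
  apply: (root_unip_rad_comm fo hQ hP ij) => //.
  apply: (root_unip_rad_conj fo hP ji) => //; first exact: (rootV topI ji).
  exact: unip_rad_root Xa'.
have [s|ns] := boolP (same_root i j k h); last first.
  have [o|no] := boolP (same_root j i k h).
    2: by apply: (nonpar k h) => //; rewrite /parallel negb_or ns.
  have Xa' : X j i P u by rewrite -(same_rootE hP ji o).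
  have cya : y^-1 * u * y = u.
    by rewrite -mulgA (root_abelian topI ji (root_top hP ji Xa') Yy) mulKg.
  have -> : comm_elt u (y * x * y^-1) = y * comm_elt u x * y^-1.
    by rewrite comm_elt_mul -{2}cya !mulgA mulgV mul1g mulgK.
  by apply: KC; apply: (YK ji).
have Xa' : X i j P u by rewrite -(same_rootE hP ij s).
have [f [i1 [j1 [i2 [j2 [i3 [j3 [fo [ij1 f1 p1] [ij2 f2 p2] [ij3 f3 p3] sp]]]]]]]] :=
    split_root ij.
have [x1 [x2 [x3 [X1 X2 X3 ->]]]] := sp _ _ hP Xa'.
have [Qt [p [pM pk]]] := quotient_exists nK'.
have cP w w' : K (comm_elt w w') <-> commute (p w) (p w').
  by rewrite -comm_elt1P -morph_comm // pk.
set z := y * x * y^-1.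
have c1 : commute (p x1) (p z) by apply/cP; apply: (nonpar i1 j1).
have c3 : commute (p x3) (p z) by apply/cP; apply: (nonpar i3 j3).
have c2 : commute (p (x2 * x1^-1 * x2^-1)) (p z).
  have [g go [gij gkh]] := exists_height ij ij2 p2.
  have [w Vw ew] := unip_rad_conj_z go hQ ij gij
     (unip_rad_root ij2 gkh (rootV topI ij2 X2)) Xx Yy.
  have : commute (p x1^-1) (p (x2^-1 * z * x2^-1^-1)).
    rewrite ew pM morphV //; apply: commuteM.
      apply/commute_sym/commuteV/commute_sym/cP/rel_FU_comm.
        exact: rel_FU_root X1.
      by apply: unip_rad_FU Vw.
    by apply/commute_sym/commuteV/commute_sym.
  move=> /cP/(KC x2); rewrite comm_elt_mul => H; apply/cP; move: H.
  by rewrite invgK !mulgA mulgV mul1g mulgK.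
apply/cP; rewrite (_ : comm_elt x1 x2 * x3 = x1 * (x2 * x1^-1 * x2^-1) * x3); last first.
  by rewrite /comm_elt !mulgA.
rewrite (pM _ x3) (pM x1); apply: commute_sym.
by do 2?[apply: commuteM]; apply: commute_sym.
Qed.

(** The SL2 commutators and [EU(P o Q)] generate [[EU P, EU Q]] as a normal
    subgroup: modulo [K], every root element of level [P] commutes with every
    member of the generating set [z_gens] of [EU Q]. *)
Lemma mutual_commutator_sub : comm_subgroup (rel_EU P) (rel_EU Q) `<=` K.
Proof.
have [Qt [p [pM pk]]] := quotient_exists nK'.
have cP w w' : K (comm_elt w w') <-> commute (p w) (p w').
  by rewrite -comm_elt1P -morph_comm // pk.
case: (nK') => sK _; apply: (span_min sK) => _ [u Pu [v Qv <-]]; apply/cP.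
have := span_commute pM (T := rel_EU Q)
  (S := [set x * s * x^-1 | x in [set: G] & s in rel_FU P]) _ Pu (sub_group_span Qv).
apply=> u1 v1 [g _ [x Fx <-]] Qv1.
suff H : forall w, rel_EU Q w -> commute (p x) (p w).
  have := H (g^-1 * v1 * g^-1^-1) _.
  case: (rel_EU_normal Q) => _ nEU /(_ (nEU _ _ Qv1))/cP/(KC g).
  by rewrite comm_elt_mul !mulgA !invgK mulgV mul1g mulgK => /cP.
move=> w /(rel_EU_zgen hQ) Zw.
apply: (span_commute pM _ Fx Zw) => {Fx Zw}x {}w [k [h [kh Xx]]] [Fw|].
  by apply/cP/rel_FU_comm => //; apply: rel_FU_root Xx.
by move=> [i [j [a [y [ij _ Xa Yy ->]]]]]; apply/cP/(root_z_comm kh ij).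
Qed.

End Mutual.

(** Let [v] be in a unipotent radical whose Levi factor contains [x] and [y].
    Modulo [EU(P o Q)], both [x] and [y] move [v] by elements [m] and [m'] of
    levels [P] and [Q], on which the other one acts trivially; so [x * y] and
    [y * x] both move [v] by [m * m'].  Roots proportional to [(i, j)] are
    split. *)
Lemma sl2_comm_central P Q i j x y g : ideal P -> ideal Q -> i != j ->
  X i j P x -> X j i Q y -> rel_EU (P ** Q) (comm_elt (comm_elt x y) g).
Proof.
move=> hP hQ ij; have ji : j != i by rewrite eq_sym.
move=> Xx0 Yy0; suff main : forall x y, X i j P x -> X j i Q y ->
    rel_EU (P ** Q) (comm_elt (comm_elt x^-1 y^-1) g).
  by rewrite -[x]invgK -[y]invgK; apply: main;
    [apply: (rootV hP ij) | apply: (rootV hQ ji)].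
move=> {Xx0 Yy0}{}x {}y Xx Yy.
have hPQ := form_prod_form hP hQ.
have [Qt [p [pM pk]]] := quotient_exists (rel_EU_normal (P ** Q)).
have cP u v : rel_EU (P ** Q) (comm_elt u v) <-> commute (p u) (p v).
  by rewrite -comm_elt1P -morph_comm // pk.
have VM f w : V f (P ** Q) w -> rel_EU (P ** Q) w.
  by move=> Vw; apply: rel_FU_EU; apply: unip_rad_FU Vw.
apply/cP.
have nonpar k h v : k != h -> ~~ parallel i j k h -> X k h top v ->
    commute (p (comm_elt x^-1 y^-1)) (p v).
  move=> kh np Xv; have [f fo [fij fkh]] := exists_height ij kh np.
  have Vv : V f top v by apply: unip_rad_root Xv.
  pose m := comm_elt x v; pose m' := comm_elt y v.
  have Vm : V f P m by apply: (unip_rad_top hP); apply: (root_unip_rad_comm fo hP topI ij).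
  have Vm' : V f Q m'.
    by apply: (unip_rad_top hQ); apply: (root_unip_rad_comm fo hQ topI ji).
  have c1 : commute (p x) (p m').
    by apply/cP; apply: VM; apply: (root_unip_rad_comm fo hP hQ ij).
  have c2 : commute (p y) (p m).
    by apply/cP; apply: (VM f); rewrite form_prodC; apply: (root_unip_rad_comm fo hQ hP ji).
  have c3 : commute (p m) (p m').
    by apply/cP; apply: (VM f); apply: (unip_rad_comm fo).
  have e1 : p x * p v = p m * p v * p x by rewrite -!pM /m -comm_eltE.
  have e2 : p y * p v = p m' * p v * p y by rewrite -!pM /m' -comm_eltE.
  have ea : p x * p y * p v = p m * p m' * p v * (p x * p y).
    by rewrite -mulgA e2 2!mulgA c1 -(mulgA (p m')) e1 !mulgA c3.
  have eb : p y * p x * p v = p m * p m' * p v * (p y * p x).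
    by rewrite -mulgA e1 2!mulgA c2 -(mulgA (p m)) e2 !mulgA.
  have -> : p (comm_elt x^-1 y^-1) = (p y * p x)^-1 * (p x * p y).
    by rewrite /comm_elt !invgK !pM !(morphV pM) invgM !mulgA.
  move: (p x * p y) (p y * p x) ea eb => u w ea eb.
  rewrite /commute -mulgA ea.
  have -> : p m * p m' * p v = w * p v * w^-1 by rewrite eb mulgK.
  by rewrite -!mulgA mulKg.
have any k h v : k != h -> X k h top v -> commute (p (comm_elt x^-1 y^-1)) (p v).
  move=> kh Xv; have [par|] := boolP (parallel i j k h); last by move=> /nonpar; apply.
  have [f [i1 [j1 [i2 [j2 [i3 [j3 [fo [ij1 f1 p1] [ij2 f2 p2] [ij3 f3 p3] sp]]]]]]]] :=
    split_root kh.
  have tr m m' : ~~ parallel k h m m' -> ~~ parallel i j m m'.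
    apply: contra; move: par; rewrite /parallel /same_root.
    by case/orP=> /orP[]/andP[/eqP -> /eqP ->]; rewrite ?nK //;
      case/orP=> /orP[]/andP[/eqP -> /eqP ->]; rewrite ?nK ?eqxx ?orbT.
  have [x1 [x2 [x3 [X1 X2 X3 ->]]]] := sp _ _ topI Xv.
  have c1 := nonpar _ _ _ ij1 (tr _ _ p1) X1.
  have c2 := nonpar _ _ _ ij2 (tr _ _ p2) X2.
  have c3 := nonpar _ _ _ ij3 (tr _ _ p3) X3.
  move: (comm_elt x^-1 y^-1) c1 c2 c3 => u c1 c2 c3.
  rewrite /comm_elt !pM !(morphV pM).
  by do 4?[apply: commuteM] => //; apply: commuteV.
have : rel_FU top g by [].
set u := comm_elt _ _; move=> Fg.
apply: (span_commute pM (S := [set u]) (T := root_gens top)) => //.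
  by move=> _ v -> [k [h [kh Xv]]]; apply: any Xv.
exact: sub_group_span.
Qed.

End MutualCommutators.

(** * Weyl group moves *)

Section WeylMoves.
Implicit Types (x y z : G).

Lemma conj_comp (H : groupType) (w w' x : H) :
  (w * w') * x * (w * w')^-1 = w * (w' * x * w'^-1) * w^-1.
Proof. by rewrite invgM !mulgA. Qed.

Lemma conj_mul (H : groupType) (w x y : H) :
  w * (x * y) * w^-1 = (w * x * w^-1) * (w * y * w^-1).
Proof. by rewrite !mulgA mulgVK. Qed.

Lemma conj_id (H : groupType) (w x : H) : commute w x -> w * x * w^-1 = x.
Proof. by move=> ->; rewrite mulgK. Qed.

Lemma conj_id_commute (H : groupType) (w x : H) : w * x * w^-1 = x -> commute w x.
Proof. by move=> e; rewrite /commute -{2}e mulgVK. Qed.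

Lemma short_commute_row i j h a b : ap i j -> ap i h -> ap j h ->
  commute (t i j a) (t i h b).
Proof.
move=> ij ih jh; apply: (rel_comm St) => //.
- by rewrite eq_sym (ap_neq ij).
- exact: ap_neq ih.
- by rewrite eq_sym (neg_neq St).
- exact: ap_neqN jh.
Qed.

Lemma short_commute_col i j h a b : ap i j -> ap i h -> ap j h ->
  commute (t i h a) (t j h b).
Proof.
move=> ij ih jh; apply: (rel_comm St) => //.
- by rewrite eq_sym (ap_neq jh).
- exact: ap_neq ih.
- exact: ap_neqN ij.
- by rewrite eq_sym (neg_neq St).
Qed.

Lemma rel_EU_conj P g x : rel_EU P x -> rel_EU P (g * x * g^-1).
Proof. by move=> Px; case: (rel_EU_normal P) => _ h; apply: h. Qed.

Lemma comm_EU_normal P Q : normal (comm_subgroup (rel_EU P) (rel_EU Q)).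
Proof. by apply: comm_subgroup_normal => g x; apply: rel_EU_conj. Qed.

(** Short root elements come from the relation [[t_ih(a), t_hj(b)] = t_ij(ab)].
    The generators of the form parameter of the product then come from the
    relations that produce long root elements, whose short factors have already
    been obtained. *)
Lemma rel_EU_prod_sub P Q : ideal P -> ideal Q ->
  rel_EU (P ** Q) `<=` comm_subgroup (rel_EU P) (rel_EU Q).
Proof.
move=> hP hQ; set C := comm_subgroup _ _; have hPQ := form_prod_form hP hQ.
have nC : normal C := comm_EU_normal P Q.
have [[C1 CM CV] CC] := nC.
have zPQ := form_prod_zmod1 F P Q.
have CR x y : rel_EU P x -> rel_EU Q y -> C (comm_elt x y) by apply: comm_subgroupE.
have CR' x y : rel_EU P x -> rel_EU Q y -> C (comm_elt y x).
  by move=> Px Qy; rewrite -comm_eltV; apply: (CV); apply: CR.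
have CN x y : C x -> C (comm_elt x y).
  by move=> Cx; rewrite /comm_elt -!mulgA; apply: (CM) => //; rewrite mulgA; apply: (CC); apply: (CV).
have Pt i j a : ap i j -> P.1 a -> rel_EU P (t i j a).
  by move=> ij Pa; apply: (rel_EU_root (ap_neq ij)); apply: mem_short.
have Qt i j a : ap i j -> Q.1 a -> rel_EU Q (t i j a).
  by move=> ij Pa; apply: (rel_EU_root (ap_neq ij)); apply: mem_short.
have short i j a : ap i j -> (P ** Q).1 a -> C (t i j a).
  move=> ij; pose S := [set a | C (t i j a)]; suff: (P ** Q).1 `<=` S by apply.
  have [h /andP[hi hj]] := third_index St i j; have ih : ap i h by rewrite apC.
  apply: form_prod_ideal_ind.
  - apply/zmod_closedP; split; first by rewrite /S /= short0.
    by move=> x y Sx Sy; rewrite /S /= (rel_add St) // shortN //; apply: (CM) => //; apply: (CV).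
  - by move=> x y Px Qy; rewrite /S /= -(rel_mul St _ _ ih hj ij); apply: CR; [exact: Pt|exact: Qt].
  - by move=> x y Px Qy; rewrite /S /= -(rel_mul St _ _ ih hj ij); apply: CR'; [exact: Pt|exact: Qt].
apply: rel_EU_min => // i j /root_cases[ij|->{j}].
  by rewrite root_short // => _ [a Pa <-]; apply: short.
rewrite root_long => _ [g Kg <-].
have [j /andP[ji _]] := third_index St i i; have ij : ap i j by rewrite apC.
have inj : i != neg i by rewrite eq_sym (neg_neq St).
have jnj : j != neg j by rewrite eq_sym (neg_neq St).
pose S := [set g | Lam g /\ C (l i g)].
suff : S g by case.
have main a g' : (P ** Q).1 (a * g')%R -> Lam g' ->
    C (comm_elt (t i j a) (l j g')) -> S (a * g' * bar a)%R.
  move=> kg Lg Cc; split; first exact: Lambda_bar.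
  rewrite (_ : l i _ = (t i (neg j) (bar (c j) * a * g')%R)^-1 * comm_elt (t i j a) (l j g')).
    apply: (CM) => //; apply: (CV); apply: short; rewrite ?apNr //.
    by rewrite -mulrA; apply: (ideal_mull hPQ).
  by rewrite (rel_tl St) // mulKg.
move: Kg; apply: form_prod_param_ind.
- apply/zmod_closedP; split; first by split; [exact: (zmod0 (Lambda_subgroup F))|rewrite long0].
  move=> x y [Lx Cx] [Ly Cy]; split; first exact: (zmodB (Lambda_subgroup F)).
  by rewrite (rel_ladd St) ?longN //; [apply: (CM) => //; apply: (CV) | exact: (zmodN (Lambda_subgroup F))].
- move=> k Kk; split; first exact: Lambda_minE.
  have := rel_long St (bar (c i) * k)%R 1%R ij.
  rewrite mulr1 mulrA (c_unit St) mul1r => <-.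
  by apply: CN; apply: short => //; apply: (ideal_mull hPQ).
- move=> k a Kk La; apply: main => //; first by apply: (ideal_mulr hPQ).
  by apply: CN; apply: short.
- move=> b g' Qb Pg; apply: main => //.
  + by apply: form_prod_mulr => //; apply: (param_ideal hP).
  + exact: (param_Lambda hP).
  + by apply: CR'; [apply: (rel_EU_root jnj); apply: mem_long | exact: Qt].
- move=> b g' Qb Pg; apply: main => //.
  + by apply: form_prod_mull => //; apply: (param_ideal hQ).
  + exact: (param_Lambda hQ).
  + by apply: CR; [exact: Pt | apply: (rel_EU_root jnj); apply: mem_long].
Qed.

(** The usual representative of the reflection that exchanges [i] and [k]. *)
Lemma weyl_short i j k : ap i j -> ap k i -> ap k j -> exists w,
  (forall a, w * t i j a * w^-1 = t k j a) /\
  (forall b, w * t j i b * w^-1 = t j k b).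
Proof.
move=> ij ki kj; have ik : ap i k by rewrite apC.
have ji : ap j i by rewrite apC. have jk : ap j k by rewrite apC.
exists (t k i 1 * t i k (-1)%R * t k i 1); split=> a; rewrite !conj_comp.
  rewrite (comm_elt_conj (t k i 1) (t i j a)) (rel_mul St) // mul1r.
  rewrite (conj_mul (t i k _)) (comm_elt_conj (t i k _)) (rel_mul St) // mulN1r.
  rewrite (conj_id (short_commute_row _ _ ik ij kj)) -(mulgA (t i j _)) (short_commute_col a a ki kj ij).
  rewrite (mulgA (t i j _)) -(rel_add St) // addNr short0 // mul1g.
  exact: conj_id (short_commute_row _ _ ki kj ij).
rewrite (conj_id (w := t k i 1) (x := t j i a)); last exact: short_commute_col kj ki ji.
rewrite (comm_elt_conj (t i k _)) -comm_eltV.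
rewrite (rel_mul St) // mulrN1 shortN // invgK (conj_mul (t k i 1)).
rewrite (comm_elt_conj (t k i 1) (t j k a)) -comm_eltV (rel_mul St) // mulr1.
rewrite (conj_id (w := t k i 1) (x := t j i a)); last exact: short_commute_col kj ki ji.
by rewrite -mulgA (short_commute_row _ _ jk ji ki) mulKg.
Qed.

(** Two of the three factors of a Weyl element already move [l j g], and the
    third fixes the result.  A unit [u] more general than one is needed because
    the same Weyl element, read with negated indices, has factors with other
    units as parameters. *)
Lemma weyl_long_aux i j u g : ap i j -> (forall a, u * a = a * u)%R ->
  (u * bar u = 1)%R -> Lam g ->
  (t j i (- bar u)%R * t i j u) * l j g * (t j i (- bar u)%R * t i j u)^-1 = l i g.
Proof.
move=> ij uC uu Lg; have ji : ap j i by rewrite apC.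
have uC' a : (bar u * a = a * bar u)%R by rewrite -[a](barK F) -!barM uC.
have eg : (lam * bar g = - g)%R by rewrite {2}(Lambda_maxE Lg) opprK.
have LN := zmodN (Lambda_subgroup F) Lg.
rewrite conj_comp (comm_elt_conj (t i j u)) (rel_tl St) //.
have -> : (u * g * bar u = g)%R by rewrite uC -mulrA uu mulr1.
have inj : i != neg i by rewrite eq_sym (neg_neq St).
have jnj : j != neg j by rewrite eq_sym (neg_neq St).
have e3 : t j i (- bar u)%R * l j g * (t j i (- bar u)%R)^-1 = l j g.
  by apply/conj_id/(rel_tlC St) => //; apply: ap_neq ij.
have e2 : t j i (- bar u)%R * l i g * (t j i (- bar u)%R)^-1 =
    (t i (neg j) (bar (c j) * u * g)%R)^-1 * l j g * l i g.
  rewrite comm_elt_conj (rel_tl St) //.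
  have -> : (- bar u * g * bar (- bar u) = g)%R.
    by rewrite barN barK mulNr mulrN mulNr opprK uC' -mulrA uC' uu mulr1.
  rewrite (rel_flip St (i := j) (j := neg i)) ?apNr // nK -shortN ?apNr //.
  do 3 f_equal; rewrite mulrN mulNr barN mulrN opprK !barM !barK c_negE.
  rewrite -!mulrA mulrA !mulrA -(c_central St) !mulrA (c_unit St) mul1r.
  by rewrite lam_central -(mulrA (bar (c j))) eg mulrN mulNr -!mulrA uC.
have e1 : t j i (- bar u)%R * t i (neg j) (bar (c j) * u * g)%R
    * (t j i (- bar u)%R)^-1 = (l j g)^-1 * (l j g)^-1 * t i (neg j) (bar (c j) * u * g)%R.
  rewrite comm_elt_conj (rel_long St) //.
  have -> : (c j * - bar u * (bar (c j) * u * g) = - g)%R.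
    rewrite mulrN mulNr -!mulrA (mulrA (bar u)) uC' -!mulrA (mulrA (c j)) (c_unit St).
    by rewrite mul1r (mulrA (bar u)) uC' uu mul1r.
  by rewrite barN mulrN eg opprK (rel_ladd St) // longN.
rewrite 2!conj_mul e1 e2 e3 !mulgA mulgK mulgVK.
by rewrite -mulgA (rel_ll St _ Lg Lg) ?mulKg ?(ap_neqN ij).
Qed.

Lemma weyl_long i j : ap i j -> exists w, forall g, Lam g ->
  w * l j g * w^-1 = l i g /\ w * l (neg j) g * w^-1 = l (neg i) g.
Proof.
move=> ij; have ji : ap j i by rewrite apC.
have nij : ap (neg i) (neg j) by rewrite apNl apNr.
have nji : ap (neg j) (neg i) by rewrite apC.
have inj : i != neg i by rewrite eq_sym (neg_neq St).
exists (t i j 1 * (t j i (- 1)%R * t i j 1)) => g Lg; split; rewrite conj_comp.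
  have := @weyl_long_aux i j 1%R g ij; rewrite bar1 => -> //; last first.
  - by rewrite mulr1.
  - by move=> a; rewrite mulr1 mul1r.
  by apply/conj_id/(rel_tlC St) => //; rewrite eq_sym (ap_neq ij).
pose u := (c i * bar (c j))%R.
have bu : (bar u = c j * bar (c i))%R by rewrite barM barK.
have e1 : t i j 1 = t (neg j) (neg i) (- bar u)%R.
  by rewrite (rel_flip St) // bar1 mulr1 bu.
have e2 : t j i (- 1)%R = t (neg i) (neg j) u.
  by rewrite (rel_flip St) // barN bar1 mulrN mulr1 opprK.
have uC a : (u * a = a * u)%R.
  by rewrite /u -mulrA barc_central !mulrA (c_central St _ a).
rewrite (conj_comp (t j i _) (t i j 1)) (conj_id (w := t i j 1) (x := l (neg j) g)).
  rewrite -conj_comp e1 e2; apply: weyl_long_aux => //.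
  by rewrite bu /u mulrA -(mulrA (c i)) bar_c mulr1 (c_unit St).
rewrite e1; apply: (rel_tlC St) => //.
  by rewrite (inj_eq neg_inj) (ap_neq ij).
by rewrite (inj_eq neg_inj) eq_sym (neg_neq St).
Qed.

Definition sl2_comm i j P Q : set G :=
  [set comm_elt x y | x in X i j P & y in X j i Q].

(** One group element must serve all levels and both root subgroups at once,
    so that it carries SL2 commutators to SL2 commutators. *)
Definition movable i j k h := exists w, forall P Q y, ideal P -> ideal Q ->
  sl2_comm i j P Q y -> sl2_comm k h P Q (w * y * w^-1).

Lemma movable_trans i j k h m p :
  movable i j k h -> movable k h m p -> movable i j m p.
Proof.
move=> [w Hw] [w' Hw']; exists (w' * w) => P Q y hP hQ Y; rewrite conj_comp.
by apply: Hw' => //; apply: Hw.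
Qed.

Lemma movable_flip i j k h : i != j -> k != h ->
  movable (neg j) (neg i) k h -> movable i j k h.
Proof.
move=> ij kh [w Hw]; exists w => P Q y hP hQ [x Xx [y' Yy <-]].
have ji : j != i by rewrite eq_sym.
apply: Hw => //; exists x; first by rewrite -root_flip.
by exists y' => //; rewrite -root_flip.
Qed.

Lemma movable_flipr i j k h : i != j -> k != h ->
  movable i j k h -> movable i j (neg h) (neg k).
Proof.
move=> ij kh [w Hw]; exists w => P Q y hP hQ /(Hw _ _ _ hP hQ)[x Xx [y' Yy <-]].
have hk : h != k by rewrite eq_sym.
exists x; first by rewrite -root_flip.
by exists y' => //; rewrite -root_flip.
Qed.

Lemma movable_third i j k : ap i j -> ap k i -> ap k j -> movable i j k j.
Proof.
move=> ij ki kj; have [w [w1 w2]] := weyl_short ij ki kj; exists w => P Q y hP hQ.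
have ji : ap j i by rewrite apC. have jk : ap j k by rewrite apC.
move=> [x Xx [z Xz <-]]; move: Xx Xz; rewrite !root_short // => -[a Pa <-] [b Qb <-].
rewrite comm_elt_mul w1 w2; exists (t k j a); first exact: mem_short.
by exists (t j k b) => //; apply: mem_short.
Qed.

Lemma movable_fst i j k : ap i j -> ap k j -> movable i j k j.
Proof.
move=> ij kj; have [ki|nki] := boolP (ap k i); first exact: movable_third.
have [m /andP[mi mj]] := third_index St i j.
have mk : ap m k.
  have : (k == i) || (k == neg i) by move: nki; rewrite /apart negb_and !negbK.
  by move=> /orP[]/eqP ->; rewrite ?apNr.
apply: (@movable_trans _ _ m j); first exact: movable_third.
by apply: movable_third => //; rewrite apC.
Qed.

Lemma movable_snd i j k : ap i j -> ap i k -> movable i j i k.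
Proof.
move=> ij ik; rewrite -(nK i) -(nK k).
have h1 : ap (neg j) (neg i) by rewrite apNl apNr apC.
have h2 : ap (neg k) (neg i) by rewrite apNl apNr apC.
apply: movable_flipr; rewrite ?nK ?(ap_neq ij) ?(ap_neq h2) //.
by apply: movable_flip; rewrite ?nK ?(ap_neq ij) ?(ap_neq h2) //; apply: movable_fst.
Qed.

(** The moves exchange one index for another that differs from both indices of
    the root up to sign; three indices up to sign suffice to connect all short
    roots. *)
Lemma movable_short i j k h : ap i j -> ap k h -> movable i j k h.
Proof.
move=> ij kh.
have [hi|nhi] := boolP (ap i h).
  apply: (@movable_trans _ _ i h); first exact: movable_snd.
  exact: movable_fst.
have [m /andP[mi mk]] := third_index St i k.
have im : ap i m by rewrite apC. have km : ap k m by rewrite apC.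
apply: (@movable_trans _ _ i m); first exact: movable_snd.
apply: (@movable_trans _ _ k m); first exact: movable_fst.
exact: movable_snd.
Qed.

Lemma movable_long i j : ap i j -> movable j (neg j) i (neg i).
Proof.
move=> ij; have [w Hw] := weyl_long ij; exists w => P Q y hP hQ.
have Xneg m R : X (neg m) m R = [set l (neg m) g | g in R.2].
  by rewrite -{2}(nK m) root_long.
move=> [x Xx [z Xz <-]]; move: Xx Xz; rewrite root_long Xneg => -[a Pa <-] [b Qb <-].
rewrite comm_elt_mul (Hw _ (param_Lambda hP Pa)).1 (Hw _ (param_Lambda hQ Qb)).2.
exists (l i a); first exact: mem_long.
by exists (l (neg i) b) => //; rewrite Xneg; exists b.
Qed.

Lemma long_disjoint i k h P Q x y : ideal P -> ideal Q -> k != h ->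
  ap i k -> ap i h -> X i (neg i) P x -> X k h Q y -> commute x y.
Proof.
move=> hP hQ kh ik ih; rewrite root_long => -[a Pa <-].
have La := param_Lambda hP Pa.
case: (root_cases kh) => [kh'|->].
  rewrite root_short // => -[b _ <-]; apply/commute_sym/(rel_tlC St) => //.
    by rewrite eq_sym (ap_neq ih).
  by apply: ap_neqN; rewrite apC.
rewrite root_long => -[b Qb <-]; apply: (rel_ll St) => //; first exact: ap_neqN ik.
exact: (param_Lambda hQ).
Qed.

End WeylMoves.

(** * Computations in GL3 *)

Section GL3.
Variables (H : groupType) (p : G -> H).
Hypothesis pM : {morph p : x y / x * y}.
Notation T i j a := (p (t i j a)).

Lemma T_mul i j h a b : ap i j -> ap j h -> ap i h ->
  comm_elt (T i j a) (T j h b) = T i h (a * b)%R.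
Proof. by move=> ij jh ih; rewrite -(morph_comm pM) (rel_mul St). Qed.

Lemma T_mul' i j h a b : ap i j -> ap j h -> ap i h ->
  comm_elt (T j h b) (T i j a) = T i h (- (a * b))%R.
Proof.
by move=> ij jh ih; rewrite -comm_eltV T_mul // shortN // (morphV pM).
Qed.

Lemma T_add i j a b : ap i j -> T i j (a + b)%R = T i j a * T i j b.
Proof. by move=> ij; rewrite (rel_add St) // pM. Qed.

Lemma T_opp i j a : ap i j -> T i j (- a)%R = (T i j a)^-1.
Proof. by move=> ij; rewrite shortN // (morphV pM). Qed.

Lemma T_0 i j : ap i j -> T i j 0 = 1.
Proof. by move=> ij; rewrite short0 // (morph1 pM). Qed.

Lemma T_commute x y : commute x y -> commute (p x) (p y).
Proof. by move=> xy; rewrite /commute -!pM xy. Qed.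

(** Roots with indices among three that are distinct up to sign form a root
    system of type A2, and the relations among their root elements are those of
    GL3.  The map [p] allows to compute modulo a normal subgroup. *)
Section Indices.
Variables (i j m : I).
Hypotheses (ij : ap i j) (im : ap i m) (jm : ap j m).

Let ji : ap j i. Proof. by rewrite apC. Qed.
Let mi : ap m i. Proof. by rewrite apC. Qed.
Let mj : ap m j. Proof. by rewrite apC. Qed.

(** The root elements for [(i, m)] and [(j, m)] commute and form the columns of
    length two on which the elements for [(i, j)] and [(j, i)] act as two by
    two matrices; for [(m, i)] and [(m, j)] these are rows. *)
Lemma col_act12 a x1 x2 :
  T i j a * (T i m x1 * T j m x2) * (T i j a)^-1 = T i m (x1 + a * x2)%R * T j m x2.
Proof.
rewrite conj_mul (conj_id (T_commute (short_commute_row _ _ ij im jm))) comm_elt_conj T_mul //.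
by rewrite mulgA -T_add.
Qed.

Lemma col_act21 b x1 x2 :
  T j i b * (T i m x1 * T j m x2) * (T j i b)^-1 = T i m x1 * T j m (x2 + b * x1)%R.
Proof.
rewrite conj_mul (conj_id (T_commute (short_commute_row _ _ ji jm im))) comm_elt_conj T_mul //.
rewrite [RHS](T_commute (short_commute_col _ _ ij im jm)) addrC T_add //.
by rewrite -!mulgA; congr (_ * _); apply: (T_commute (short_commute_col _ _ ij im jm)).
Qed.

Lemma row_act12 a x1 x2 :
  T i j a * (T m i x1 * T m j x2) * (T i j a)^-1 = T m i x1 * T m j (x2 - x1 * a)%R.
Proof.
rewrite conj_mul (conj_id (T_commute (short_commute_col _ _ im ij mj))) comm_elt_conj T_mul' //.
rewrite [RHS](T_commute (short_commute_row _ _ mi mj ij)) addrC T_add //.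
by rewrite -!mulgA; congr (_ * _); apply: (T_commute (short_commute_row _ _ mi mj ij)).
Qed.

Lemma row_act21 b x1 x2 :
  T j i b * (T m i x1 * T m j x2) * (T j i b)^-1 = T m i (x1 - x2 * b)%R * T m j x2.
Proof.
rewrite conj_mul (conj_id (T_commute (short_commute_col _ _ jm ji mi))) comm_elt_conj T_mul' //.
by rewrite mulgA -T_add.
Qed.

Lemma sl2_conj_expand a b x :
  comm_elt (T i j a) (T j i b) * x * (comm_elt (T i j a) (T j i b))^-1 =
  T i j a * (T j i b * (T i j (- a)%R * (T j i (- b)%R * x * (T j i (- b)%R)^-1)
    * (T i j (- a)%R)^-1) * (T j i b)^-1) * (T i j a)^-1.
Proof. by rewrite !T_opp // /comm_elt !invgM !invgK !mulgA. Qed.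

Lemma sl2_act_im a b x :
  comm_elt (T i j a) (T j i b) * T i m x * (comm_elt (T i j a) (T j i b))^-1 =
  T i m (x + (a * b + a * b * a * b) * x)%R * T j m (b * a * b * x)%R.
Proof.
rewrite sl2_conj_expand -[T i m x]mulg1 -(T_0 jm) col_act21 col_act12 col_act21 col_act12.
rewrite add0r; congr (T i m _ * T j m _); rewrite !(mulNr, mulrN) ?opprK !mulrDr.
  by rewrite mulrN addKr -addrA mulrDl !mulrA.
by rewrite addKr !mulrA.
Qed.

Lemma sl2_act_jm a b x :
  comm_elt (T i j a) (T j i b) * T j m x * (comm_elt (T i j a) (T j i b))^-1 =
  T i m (- (a * b * a) * x)%R * T j m (x - b * a * x)%R.
Proof.
rewrite sl2_conj_expand -[T j m x]mul1g -(T_0 im) col_act21 col_act12 col_act21 col_act12.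
rewrite mulr0 addr0 add0r; congr (T i m _ * T j m _).
  by rewrite !mulNr mulrDr addKr !mulrN !mulrA.
by rewrite mulNr mulrN mulrA.
Qed.

Lemma sl2_act_mj a b x :
  comm_elt (T i j a) (T j i b) * T m j x * (comm_elt (T i j a) (T j i b))^-1 =
  T m i (x * - (b * a * b))%R * T m j (x + x * (b * a + b * a * b * a))%R.
Proof.
rewrite sl2_conj_expand -[T m j x]mul1g -(T_0 mi) row_act21 row_act12 row_act21 row_act12.
rewrite sub0r !mulrN !opprK; congr (T m i _ * T m j _).
  by rewrite mulrDl opprD addrA subrr sub0r !mulrA.
by rewrite [in X in (_ - X * a)%R]mulrDl [in X in (_ - X * a)%R]opprD addrA subrr
  sub0r mulNr opprK -addrA mulrDr !mulrA.
Qed.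

(** Expand [t_mi(be * e)] as the commutator of [t_mj(be)] and [t_ji(e)] and
    conjugate both by [t_im(xi)].  The hypotheses say that the error terms are
    trivial; a factor then moves cyclically from one side of an SL2 commutator
    to the other. *)
Lemma gl3_shift xi be e :
  (forall x, x \in [:: T j i e; T j m (e * xi)%R; T m i (be * e)%R] ->
      commute (T i j (xi * be)%R) x) ->
  T j i (e * xi * be * e)%R = 1 ->
  comm_elt (T i m xi) (T m i (be * e)%R) = comm_elt (T m j be) (T j m (- (e * xi))%R).
Proof.
move=> hc h1; set om := T i j (xi * be)%R.
have c1 : commute om (T j i e) by apply: hc; rewrite !inE eqxx.
have c2 : commute om (T j m (- (e * xi))%R).
  by rewrite T_opp //; apply/commuteV/hc; rewrite !inE eqxx orbT.
have c3 : commute om (T m i (be * e)%R) by apply: hc; rewrite !inE eqxx !orbT.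
have c4 : commute om (T m j be) by apply: (T_commute (short_commute_col _ _ im ij mj)).
set x := T i m xi; set s := T m j be; set z1 := T j m _; set z2 := T j i e.
have e31 : T m i (be * e)%R = comm_elt s z2 by rewrite T_mul.
have xs : x * s * x^-1 = om * s by rewrite comm_elt_conj T_mul.
have xz : x * z2 * x^-1 = z1 * z2 by rewrite comm_elt_conj T_mul'.
have cz : commute z1 (T m i (be * e)%R).
  apply/comm_elt1P; rewrite T_mul // (_ : (_ * _ = - (e * xi * be * e))%R).
    by rewrite T_opp // h1 invg1.
  by rewrite mulNr !mulrA.
have key : x * T m i (be * e)%R * x^-1 = comm_elt s z1 * T m i (be * e)%R.
  rewrite {1}e31 comm_elt_mul xs xz comm_eltMl.
  rewrite (_ : comm_elt om (z1 * z2) = 1) ?mulg1; last first.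
    by apply/comm_elt1P/commuteM.
  rewrite comm_eltMr -e31 (conj_id cz) conj_id //.
  by rewrite /comm_elt; do ! apply: commuteM => //; apply: commuteV.
by rewrite /comm_elt -/x key mulgK.
Qed.

(** Conjugation by [t_mi(be)] multiplies [t_jm(al)] by [t_ji(al * be)], up to
    sign; this factor commutes with [t_im(xi)], so that conjugation by the
    inverse of [t_mi(be)] removes it again. *)
Lemma gl3_commute xi be al be' :
  T i j (xi * be')%R = 1 -> commute (T j i (al * be)%R) (T i m xi) ->
  commute (comm_elt (T i m xi) (T m i be)) (T j m al) /\
  commute (comm_elt (T i m xi) (T m i be)) (T m j be').
Proof.
move=> h1 h2; split; last first.
  apply: commute_sym; rewrite /comm_elt.
  have d1 : commute (T m j be') (T i m xi).
    by apply: commute_sym; apply/comm_elt1P; rewrite T_mul.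
  have d2 : commute (T m j be') (T m i be) by apply: (T_commute (short_commute_row _ _ mj mi ji)).
  by do ! apply: commuteM => //; apply: commuteV.
have d3 : commute (T i m xi) (T j m al) by apply: (T_commute (short_commute_col _ _ ij im jm)).
have d4 : commute (T m i be) (T j i (al * be)%R).
  by apply: (T_commute (short_commute_col _ _ mj mi ji)).
have e1 : (T m i be)^-1 * T j m al * (T m i be)^-1^-1 = T j i (al * be)%R * T j m al.
  by rewrite -T_opp // comm_elt_conj T_mul' // mulrN opprK.
have d5 : commute (T i m xi)^-1 (T j i (al * be)%R * T j m al).
  by apply/commute_sym/commuteV; apply: commute_sym; apply: commuteM => //; apply: commute_sym.
apply: conj_id_commute; rewrite /comm_elt conj_comp e1 conj_comp (conj_id d5) conj_comp.
by rewrite -e1 -(conj_comp (T m i be)) mulgV invg1 mul1g mulg1 (conj_id d3).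
Qed.

End Indices.
End GL3.

(** On the column [t_im, t_jm] the element [y] acts by a matrix with first column
    [(1 + ab + abab, bab)]; apart from the diagonal one, its entries are in the ideal of
    [P o Q], so that [[y, t_im(r)]] is a product of two commutators of
    root elements of levels [P o Q] and [R]. *)
Lemma short_adjacent i j m P Q R (N : set G) y g : ideal P -> ideal Q -> ideal R ->
  ap i j -> ap i m -> ap j m -> normal N ->
  (forall u g, rel_EU (P ** Q) u -> rel_EU R g -> N (comm_elt u g)) ->
  sl2_comm i j P Q y -> X i m R g -> N (comm_elt y g).
Proof.
move=> hP hQ hR ij im jm [[_ NM _] _] hN [x + [z + <-]].
have ji : ap j i by rewrite apC.
rewrite !root_short // => -[a Pa <-] [b Qb <-] [r Rr <-].
have hPQ := form_prod_form hP hQ.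
have ab := form_prod_mull F Pa Qb; have ba := form_prod_mulr F Pa Qb.
have zPQ := ideal_zmod hPQ.
have tM h k u : ap h k -> (P ** Q).1 u -> rel_EU (P ** Q) (t h k u).
  by move=> hk Hu; apply: (rel_EU_root (ap_neq hk)); apply: mem_short.
have tR h k u : ap h k -> R.1 u -> rel_EU R (t h k u).
  by move=> hk Hu; apply: (rel_EU_root (ap_neq hk)); apply: mem_short.
have e := sl2_act_im (p := id) (fun _ _ => erefl) ij im jm a b r.
set y0 := comm_elt (t i j a) _ in e *.
rewrite /comm_elt e {e y0}.
rewrite addrC (rel_add St) // -[_ * t i m r * _]mulgA.
rewrite (short_commute_col _ _ ij im jm) !mulgA mulgK.
rewrite -(rel_mul St _ _ ij jm im) -(rel_mul St _ _ ji im jm).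
apply: NM; apply: hN; first apply: tM => //; try exact: tR.
  by apply: (zmodD zPQ) => //; rewrite -mulrA; apply: (ideal_mulr hPQ).
by apply: tM => //; apply: (ideal_mulr hPQ).
Qed.

Section Quadruple.
Variables (P Q R S : set A * set A).
Hypotheses (hP : ideal P) (hQ : ideal Q) (hR : ideal R) (hS : ideal S).
Variables (H : groupType) (p : G -> H).
Hypothesis pM : {morph p : x y / x * y}.
Notation T i j a := (p (t i j a)).
Notation U := (P ** Q).1.
Notation W := (R ** S).1.
Hypothesis cUW : forall x y, rel_EU (P ** Q) x -> rel_EU (R ** S) y -> commute (p x) (p y).
Hypothesis cUC : forall x y, rel_EU (P ** Q) x -> comm_subgroup (rel_EU R) (rel_EU S) y ->
  commute (p x) (p y).

Let hU := form_prod_form hP hQ.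
Let hW := form_prod_form hR hS.

Let cT i j k h u w : ap i j -> ap k h -> U u -> W w -> commute (T i j u) (T k h w).
Proof.
move=> ij kh Uu Ww; apply: cUW.
  by apply: (rel_EU_root (ap_neq ij)); apply: mem_short.
by apply: (rel_EU_root (ap_neq kh)); apply: mem_short.
Qed.

Let T_uw i j u w : ap i j -> U u -> W w -> T i j (u * w)%R = 1.
Proof.
move=> ij Uu Ww; have [h /andP[hi hj]] := third_index St i j.
have ih : ap i h by rewrite apC.
by rewrite -(T_mul pM _ _ ih hj ij); apply/comm_elt1P/cT.
Qed.

Let T_wu i j u w : ap i j -> U u -> W w -> T i j (w * u)%R = 1.
Proof.
move=> ij Uu Ww; have [h /andP[hi hj]] := third_index St i j.
have ih : ap i h by rewrite apC.
by rewrite -(T_mul pM _ _ ih hj ij); apply/comm_elt1P/commute_sym/cT.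
Qed.

(** For [d] in [U], the SL2 commutator [Phi i j m d] of [d * r] and [s] behaves, in
    the image of [p], like an additive function of [d].  It is independent of
    the position, it is central for the root elements of levels [R] and [S]
    that occur, and left factors of [r] may be traded for right factors of
    [s]. *)
Section Positions.
Variables (r s : A).
Hypotheses (Rr : R.1 r) (Ss : S.1 s).

Let prod_rs : W (r * s)%R. Proof. exact: form_prod_mull. Qed.

Let Phi i j m d := comm_elt (T i m (d * r)%R) (T m i s).

Let Phi_commute i j m d al be : ap i j -> ap i m -> ap j m -> U d ->
  R.1 al -> S.1 be ->
  commute (Phi i j m d) (T j m al) /\ commute (Phi i j m d) (T m j be).
Proof.
move=> ij im jm Ud Ra Sb; have ji : ap j i by rewrite apC.
apply: (gl3_commute pM) => //.
  by rewrite -mulrA T_uw //; apply: form_prod_mull.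
apply/commute_sym/cT => //; first exact: (ideal_mulr hU).
exact: form_prod_mull.
Qed.

Let Phi_shift i j m d e : ap i j -> ap i m -> ap j m -> U d ->
  comm_elt (T i m (d * r)%R) (T m i (s * e)%R) =
  comm_elt (T m j s) (T j m (- (e * (d * r)))%R).
Proof.
move=> ij im jm Ud; have ji : ap j i by rewrite apC.
apply: (gl3_shift pM) => //.
  by move=> x _; rewrite -mulrA T_uw //; apply/commute_sym/commute1.
by rewrite !mulrA -(mulrA _ r) -(mulrA _ (r * s)%R) T_uw //;
  [apply: (ideal_mull hU) | apply: (ideal_mulr hW)].
Qed.

Let comm_inv_right (x y : H) : comm_elt x y^-1 = y^-1 * comm_elt y x * y^-1^-1.
Proof. by rewrite /comm_elt !mulgA mulVg mul1g. Qed.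

(** Both sides are related by [gl3_shift] with [e = 1], up to a conjugation that
    has no effect by [gl3_commute]. *)
Let Phi_eq i j m d : ap i j -> ap i m -> ap j m -> U d -> Phi i j m d = Phi j i m d.
Proof.
move=> ij im jm Ud; have ji : ap j i by rewrite apC.
have mj : ap m j by rewrite apC.
have dr : R.1 (d * r)%R by apply: (ideal_mull hR).
have := Phi_shift 1 ij im jm Ud; rewrite mulr1 mul1r (T_opp pM) // => e.
have {e}: Phi i j m d = (T j m (d * r)%R)^-1 * Phi j i m d * (T j m (d * r)%R)^-1^-1.
  by rewrite /Phi e comm_inv_right.
have [cA _] := Phi_commute ij im jm Ud dr Ss.
move=> e; rewrite -[LHS](conj_id (commute_sym cA)) e invgK !mulgA mulgV mul1g mulgK //.
Qed.

Let Phi_cent i j m d al be : ap i j -> ap i m -> ap j m -> U d ->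
  R.1 al -> S.1 be ->
  [/\ commute (Phi i j m d) (T j m al), commute (Phi i j m d) (T m j be),
      commute (Phi i j m d) (T i m al) & commute (Phi i j m d) (T m i be)].
Proof.
move=> ij im jm Ud Ra Sb; have ji : ap j i by rewrite apC.
have [? ?] := Phi_commute ij im jm Ud Ra Sb.
by have [c3 c4] := Phi_commute ji jm im Ud Ra Sb; rewrite -(Phi_eq ij) // in c3 c4.
Qed.

Let Phi_mulr i j m d e : ap i j -> ap i m -> ap j m -> U d ->
  comm_elt (T i m (d * r)%R) (T m i (s * e)%R) = Phi i j m (e * d)%R.
Proof.
move=> ij im jm Ud; have ji : ap j i by rewrite apC.
have Ued : U (e * d)%R by apply: (ideal_mull hU).
have edr : R.1 (e * d * r)%R by apply: (ideal_mull hR).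
rewrite (Phi_shift e ij) // (T_opp pM) // comm_inv_right mulrA.
rewrite -/(Phi j i m (e * d)%R) -(Phi_eq ij) //; apply: conj_id.
by apply/commute_sym/commuteV; have [] := Phi_cent ij im jm Ued edr Ss.
Qed.

(** Here [r] itself carries no factor in [U]; instead [e] is in [U]. *)
Let Phi_one i j m e : ap i j -> ap i m -> ap j m -> U e ->
  comm_elt (T j m r) (T m j (s * e)%R) = Phi i j m e.
Proof.
move=> ij im jm Ue; have ji : ap j i by rewrite apC.
have mj : ap m j by rewrite apC.
have er : R.1 (e * r)%R by apply: (ideal_mull hR).
rewrite (gl3_shift pM ji jm im (xi := r)) ?(T_opp pM) // ?comm_inv_right.
- by apply: conj_id; apply/commute_sym/commuteV; have [] := Phi_cent ij im jm Ue er Ss.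
- move=> x; rewrite !inE => /or3P[]/eqP ->; apply: commute_sym; apply: cT => //.
    exact: (ideal_mulr hU).
  exact: (ideal_mull hU).
- by rewrite -(mulrA e) -mulrA T_uw //; apply: (ideal_mulr hW).
Qed.

Let Phi_add i j m d d' : ap i j -> ap i m -> ap j m -> U d -> U d' ->
  Phi i j m (d + d')%R = Phi i j m d' * Phi i j m d.
Proof.
move=> ij im jm Ud Ud'; rewrite {1}/Phi mulrDl (T_add pM) // comm_eltMl.
have dr : R.1 (d * r)%R by apply: (ideal_mull hR).
have [_ _ cA _] := Phi_cent ij im jm Ud' dr Ss.
by rewrite -/(Phi i j m d') (conj_id (commute_sym cA)).
Qed.

Let comm_split (x sg rr y : H) : commute x rr -> commute sg y ->
  comm_elt (x * sg) (rr * y) = x * comm_elt sg rr * x^-1 * (rr * comm_elt x y * rr^-1).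
Proof.
move=> xr sy.
have h1 : y * sg^-1 = sg^-1 * y by apply/commuteV/commute_sym.
have h2 : x^-1 * rr = rr * x^-1 by apply/commute_sym/commuteV/commute_sym.
rewrite /comm_elt !invgM -!mulgA (mulgA x^-1 rr) h2 -!mulgA !mulKg.
by rewrite (mulgA y sg^-1) h1 -!mulgA.
Qed.

(** Conjugation by [y = [t_ij(a), t_ji(b)]] takes [t_jm(r)] to
    [t_im(u r) t_jm(r - v r)] and [t_mj(s)] to [t_mi(s z) t_mj(s + s w)], with
    [u], [v], [w] and [z] in the ideal of [P o Q].  Expanding
    the commutator of these two elements gives the original one, up to the
    values of [Phi] at [-v], [-wv], [w] and [zu].  These arguments add up to
    zero since [(1 + w)(1 - v) + z u = 1], an entry of the product of the matrix of
    [y] and its inverse. *)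
Lemma short_short_commute i j m a b : ap i j -> ap i m -> ap j m -> P.1 a -> Q.1 b ->
  commute (comm_elt (T i j a) (T j i b)) (comm_elt (T j m r) (T m j s)).
Proof.
move=> ij im jm Pa Qb.
have ji : ap j i by rewrite apC. have mi : ap m i by rewrite apC.
have mj : ap m j by rewrite apC.
pose u := (- (a * b * a))%R; pose v := (b * a)%R.
pose w := (b * a + b * a * b * a)%R; pose z := (- (b * a * b))%R.
have zU := ideal_zmod hU; have zR := ideal_zmod hR; have zS := ideal_zmod hS.
have ab : U (a * b)%R by apply: form_prod_mull.
have ba : U v by apply: form_prod_mulr.
have Uu : U u by apply: (zmodN zU); apply: (ideal_mulr hU).
have Uz : U z by apply: (zmodN zU); apply: (ideal_mulr hU).
have Uw : U w by apply: (zmodD zU) => //; rewrite -mulrA; apply: (ideal_mulr hU).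
have UN : U (- v)%R by apply: (zmodN zU).
have Uwv : U (w * - v)%R by apply: (ideal_mull hU).
have Uzu : U (z * u)%R by apply: (ideal_mull hU).
have Rs : R.1 (r - v * r)%R by apply: (zmodB zR) => //; apply: (ideal_mull hR).
have Sr : S.1 (s + s * w)%R by apply: (zmodD zS) => //; apply: (ideal_mulr hS).
have cen d : U d -> commute (comm_elt (T j m r) (T m j s)) (Phi i j m d) /\
    [/\ commute (T j m r) (Phi i j m d), commute (T m j s) (Phi i j m d)
     & commute (T m j (s + s * w)%R) (Phi i j m d)].
  move=> Ud; have [c1 c2 _ _] := Phi_cent ij im jm Ud Rr Ss.
  have [_ c3 _ _] := Phi_cent ij im jm Ud Rr Sr.
  split; last by split; apply: commute_sym.
  by apply: commute_sym; rewrite /comm_elt; do ! apply: commuteM => //; apply: commuteV.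
apply: conj_id_commute; rewrite comm_elt_mul.
rewrite (sl2_act_jm pM ij im jm) (sl2_act_mj pM ij im jm).
rewrite -/u -/v -/w -/z (T_commute pM (short_commute_row _ _ mi mj ij)).
rewrite comm_split; last 2 first.
- by apply/comm_elt1P; rewrite (T_mul pM) // -mulrA T_uw //; apply: form_prod_mull.
- by apply/comm_elt1P; rewrite (T_mul pM) // mulrA T_wu //; apply: form_prod_mull.
rewrite (Phi_mulr z ij) // (conj_id (_ : commute (T m j _) (Phi i j m _))); last first.
  by have [_ []] := cen _ Uzu.
rewrite (conj_id (w := T i m _)); last first.
  rewrite -(morph_comm pM); apply: cUC; last first.
    by apply: comm_subgroupE; [apply: (rel_EU_root (ap_neq jm)) | apply: (rel_EU_root (ap_neq mj))];
      apply: mem_short.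
  by apply: (rel_EU_root (ap_neq im)); apply: mem_short => //; apply: (ideal_mulr hU).
rewrite (T_add pM) // -mulNr (T_add pM) // comm_eltMl.
have e1 : comm_elt (T j m (- v * r)%R) (T m j s * T m j (s * w)%R) =
    Phi i j m (w * - v + - v)%R.
  rewrite comm_eltMr (Phi_mulr w ji) // -(Phi_eq ij) //.
  have [_ [_ cA _]] := cen _ Uwv; rewrite (conj_id cA).
  by rewrite Phi_add // -/(Phi j i m (- v)%R) -(Phi_eq ij).
have e2 : comm_elt (T j m r) (T m j s * T m j (s * w)%R) =
    comm_elt (T j m r) (T m j s) * Phi i j m w.
  rewrite comm_eltMr (Phi_one ij) //.
  by have [_ [_ cA _]] := cen _ Uw; rewrite (conj_id cA).
have Us : U (w * - v + - v)%R by apply: (zmodD zU).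
have [c1 [c2 _ _]] := cen _ Us.
have regroup (q x y x' : H) : commute q x -> x * (q * y) * x' = q * (x * y * x').
  by move=> c0; rewrite !mulgA c0.
rewrite e1 e2 (conj_id c2) (regroup _ _ _ _ c1) -Phi_add // -Phi_add //; last first.
  by apply: (zmodD zU).
rewrite (_ : (_ + _ = 0)%R); last first.
  rewrite /w /v /z /u mulrN mulrN mulNr opprK mulrDl !mulrA.
  rewrite -opprD addrA; apply/eqP; rewrite subr_eq0; apply/eqP.
  by rewrite addrCA [LHS]addrC; congr (_ + _)%R; exact: addrC.
rewrite /Phi mul0r (T_0 pM) // (_ : comm_elt 1 _ = 1) ?mulg1 //.
exact/comm_elt1P/commute_sym/commute1.
Qed.

End Positions.
End Quadruple.

(** * Triple and quadruple commutators *)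

Section MultipleCommutators.
Implicit Types (x y z g w u v : G).

Lemma comm_elt_one (H : groupType) (N : set H) (x y : H) : normal N -> commute x y -> N (comm_elt x y).
Proof. by move=> [[N1 _ _] _] /comm_elt1P ->. Qed.

(** Conjugates of [y] differ from one another by elements of [EU(P o Q)], as [y]
    is central modulo this group; so it does not matter which of them is used
    in a commutator with [g]. *)
Lemma sl2_transfer P Q i j y g (N : set G) : ideal P -> ideal Q -> i != j ->
  normal N -> sl2_comm i j P Q y -> (forall u, rel_EU (P ** Q) u -> N (comm_elt u g)) ->
  (exists w, N (comm_elt (w * y * w^-1) g)) ->
  forall v : G, N (comm_elt (v * y * v^-1) g).
Proof.
move=> hP hQ ij [[N1 NM NV] NC] [x Xx [x' Xx' <-]] HM [w Hw] v.
set y0 := comm_elt x x' in Hw *.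
have [[_ MM MV] _] := rel_EU_normal (P ** Q).
have My (u : G) : rel_EU (P ** Q) (comm_elt u y0).
  by rewrite -comm_eltV; apply: (MV); rewrite /y0; exact: (sl2_comm_central _ hP hQ ij Xx Xx').
have -> : v * y0 * v^-1 = (comm_elt v y0 * (comm_elt w y0)^-1) * (w * y0 * w^-1).
  by rewrite !comm_elt_conj -(mulgA (comm_elt v y0)) mulKg.
rewrite comm_eltMl; apply: (NM); first exact: NC.
by apply: HM; apply: (MM) => //; apply: (MV).
Qed.

Lemma sl2_comm_mem P Q i j y : i != j -> sl2_comm i j P Q y ->
  comm_subgroup (rel_EU P) (rel_EU Q) y.
Proof.
move=> ij [x Xx [x' Xx' <-]]; apply: comm_subgroupE; first exact: (rel_EU_root ij).
by apply: (rel_EU_root (i := j) (j := i)) => //; rewrite eq_sym.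
Qed.

Lemma movable_refl i j : movable i j i j.
Proof. by exists 1 => P Q y _ _; rewrite mul1g invg1 mulg1. Qed.

(** Among three indices up to sign, one avoids both [k] and [h]. *)
Lemma long_away i k h : exists m,
  [/\ ap m k, ap m h & movable i (neg i) m (neg m)].
Proof.
have [/andP[ik ih]|nik] := boolP (ap i k && ap i h).
  by exists i; split=> //; apply: movable_refl.
have [m /andP[mk mh]] := third_index St k h; exists m; split=> //.
apply: movable_long; move: nik; apply: contraR => nmi.
have : (m == i) || (m == neg i) by move: nmi; rewrite /apart negb_and !negbK.
by move=> /orP[]/eqP e; subst m; rewrite ?apNl in mk mh; rewrite mk.
Qed.

Lemma short_away k : exists m p, [/\ ap m p, ap k m & ap k p].
Proof.
have [m /andP[mk _]] := third_index St k k.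
have [p /andP[pm pk]] := third_index St m k.
by exists m, p; rewrite ![ap _ p]apC [ap k m]apC.
Qed.

Lemma sl2_long_commute m k h P Q R y g : ideal P -> ideal Q -> ideal R -> k != h ->
  ap m k -> ap m h -> sl2_comm m (neg m) P Q y -> X k h R g -> commute y g.
Proof.
move=> hP hQ hR kh mk mh [x Xx [x' Xx' <-]] Xg.
have c1 : commute x g by apply: (long_disjoint hP hR kh mk mh).
have c2 : commute x' g.
  by apply: (@long_disjoint (neg m) k h Q R) => //; rewrite ?apNl // nK.
by apply: commute_sym; rewrite /comm_elt; do ! apply: commuteM;
   try apply: commuteV; apply: commute_sym.
Qed.

Lemma sl2_short_commute i j k P Q R y g : ideal P -> ideal Q -> ideal R -> i != j ->
  ap k i -> ap k j -> sl2_comm i j P Q y -> X k (neg k) R g -> commute y g.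
Proof.
move=> hP hQ hR ij ki kj [x Xx [x' Xx' <-]] Xg; have ji : j != i by rewrite eq_sym.
have c1 : commute g x by apply: (long_disjoint hR hP ij ki kj).
have c2 : commute g x' by apply: (long_disjoint hR hQ ji kj ki).
by apply: commute_sym; rewrite /comm_elt; do ! apply: commuteM; try apply: commuteV.
Qed.

Lemma sl2_commute_sl2 k h P Q y z : (forall g, X k h P g -> commute y g) ->
  (forall g, X h k Q g -> commute y g) -> sl2_comm k h P Q z -> commute y z.
Proof.
move=> H1 H2 [x /H1 c1 [x' /H2 c2 <-]].
by rewrite /comm_elt; do ! apply: commuteM => //; apply: commuteV.
Qed.

(** Modulo [N = [EU(P o Q), EU R]], the elements that commute with [EU R] form a
    normal subgroup that contains [EU(P o Q)]; so only SL2 commutators [y] have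
    to be considered, and only against root elements [g] of level [R].  According
    to the lengths of the two roots, [y] is moved away from [g] or next to
    it. *)
Lemma triple_commutator P Q R : ideal P -> ideal Q -> ideal R ->
  comm_subgroup (comm_subgroup (rel_EU P) (rel_EU Q)) (rel_EU R) =
  comm_subgroup (rel_EU (P ** Q)) (rel_EU R).
Proof.
move=> hP hQ hR; have hPQ := form_prod_form hP hQ.
apply/seteqP; split; last by apply: comm_subgroup_mono => //; apply: rel_EU_prod_sub.
set N := comm_subgroup (rel_EU (P ** Q)) (rel_EU R).
have nN : normal N := comm_EU_normal (P ** Q) R.
have sN : subgroup N by case: nN.
pose K := [set x | forall y, rel_EU R y -> N (comm_elt x y)].
have nK0 : normal K by apply: comm_into_normal => // g x; apply: rel_EU_conj.
suff CK : comm_subgroup (rel_EU P) (rel_EU Q) `<=` K.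
  by apply: (span_min sN) => _ [x /CK Kx [y Ry <-]]; apply: Kx.
apply: (mutual_commutator_sub hP hQ nK0).
  by move=> x Mx y Ry; apply: comm_subgroupE.
move=> i j x x' ij Xx Xx'; set y := comm_elt x x'.
have Yy : sl2_comm i j P Q y by exists x => //; exists x'.
pose T := [set z | exists v : G, z = v * y * v^-1].
have TC g z : T z -> T (g * z * g^-1).
  by move=> [h ->]; exists (g * h); rewrite invgM !mulgA.
have nK2 := comm_into_normal nN TC.
suff K2 : rel_EU R `<=` [set g | forall c, T c -> N (comm_elt g c)].
  move=> g Rg; rewrite -comm_eltV; case: sN => _ _; apply; apply: K2 => //.
  by exists 1; rewrite mul1g invg1 mulg1.
apply: (rel_EU_min nK2) => k h kh g Xg _ [w0 ->].
rewrite -comm_eltV; case: (sN) => _ _; apply.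
have Rg : rel_EU R g by apply: (rel_EU_root kh).
apply: (sl2_transfer hP hQ ij nN Yy) => [u Mu|]; first exact: comm_subgroupE.
case: (root_cases ij) => [apij|ej]; last first.
  subst j; have [m [mk mh [w Hw]]] := long_away i k h; exists w.
  apply: comm_elt_one => //.
  exact: (sl2_long_commute hP hQ hR kh mk mh (Hw _ _ _ hP hQ Yy)).
case: (root_cases kh) => [apkh|eh]; last first.
  subst h; have [m [q [mq km kq]]] := short_away k.
  have [w Hw] := movable_short apij mq; exists w; apply: comm_elt_one => //.
  exact: (sl2_short_commute hP hQ hR (ap_neq mq) km kq (Hw _ _ _ hP hQ Yy)).
have [m /andP[mk mh]] := third_index St k h; have km : ap k m by rewrite apC.
have [w Hw] := movable_short apij km; exists w.
apply: (short_adjacent hP hQ hR km apkh mh nN _ (Hw _ _ _ hP hQ Yy) Xg).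
by move=> u r; apply: comm_subgroupE.
Qed.

(** Both mutual commutator subgroups are reduced to their SL2 commutators [y] and
    [y'].  The triple formula bounds the commutators of one side with the
    [EU] of the product on the other side, which is what allows to move [y] and
    [y'] independently. *)
Lemma quadruple_commutator P Q R S : ideal P -> ideal Q -> ideal R -> ideal S ->
  comm_subgroup (comm_subgroup (rel_EU P) (rel_EU Q)) (comm_subgroup (rel_EU R) (rel_EU S)) =
  comm_subgroup (rel_EU (P ** Q)) (rel_EU (R ** S)).
Proof.
move=> hP hQ hR hS; have hPQ := form_prod_form hP hQ; have hRS := form_prod_form hR hS.
apply/seteqP; split; last by apply: comm_subgroup_mono; apply: rel_EU_prod_sub.
set C := comm_subgroup (rel_EU P) (rel_EU Q); set C' := comm_subgroup (rel_EU R) (rel_EU S).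
set N := comm_subgroup (rel_EU (P ** Q)) (rel_EU (R ** S)).
have nN : normal N := comm_EU_normal (P ** Q) (R ** S).
have sN : subgroup N by case: nN.
have NV x y : N (comm_elt x y) -> N (comm_elt y x).
  by move=> Nxy; rewrite -comm_eltV; case: sN => _ _; apply.
have CM' x y : C x -> rel_EU (R ** S) y -> N (comm_elt x y).
  by move=> Cx My; rewrite /N -(triple_commutator hP hQ hRS); apply: comm_subgroupE.
have MC' x y : rel_EU (P ** Q) x -> C' y -> N (comm_elt x y).
  move=> Mx Cy; rewrite /N comm_subgroupC -(triple_commutator hR hS hPQ).
  by rewrite comm_subgroupC; apply: comm_subgroupE.
have [_ CC'] : normal C' := comm_EU_normal R S.
have [_ CC] : normal C := comm_EU_normal P Q.
pose K := [set x | forall y, C' y -> N (comm_elt x y)].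
have nK0 : normal K by apply: comm_into_normal => // g x; apply: CC'.
suff CK : C `<=` K by apply: (span_min sN) => _ [x /CK Kx [y Ry <-]]; apply: Kx.
apply: (mutual_commutator_sub hP hQ nK0).
  by move=> x Mx y Cy; apply: MC'.
move=> i j x x' ij Xx Xx'; set y := comm_elt x x'.
have Yy : sl2_comm i j P Q y by exists x => //; exists x'.
have Cy : C y := sl2_comm_mem ij Yy.
pose T := [set z | exists v : G, z = v * y * v^-1].
have TC g z : T z -> T (g * z * g^-1).
  by move=> [h ->]; exists (g * h); rewrite invgM !mulgA.
have nK2 := comm_into_normal nN TC.
suff K2 : C' `<=` [set g | forall c, T c -> N (comm_elt g c)].
  move=> g Cg; apply: (NV); apply: K2 => //.
  by exists 1; rewrite mul1g invg1 mulg1.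
apply: (mutual_commutator_sub hR hS nK2).
  by move=> g Mg _ [h ->]; apply: (NV); apply: CM' => //; apply: CC.
move=> k h z z' kh Xz Xz' _ [w0 ->]; set y' := comm_elt z z'.
have Yy' : sl2_comm k h R S y' by exists z => //; exists z'.
have hk : h != k by rewrite eq_sym.
have Cy' : C' y' := sl2_comm_mem kh Yy'.
apply: (NV); apply: (sl2_transfer hP hQ ij nN Yy) => [u Mu|]; first exact: MC'.
case: (root_cases ij) => [apij|ej]; last first.
  subst j; have [m [mk mh [w Hw]]] := long_away i k h; exists w.
  apply: comm_elt_one => //; apply: sl2_commute_sl2 Yy' => g Xg.
    exact: (sl2_long_commute hP hQ hR kh mk mh (Hw _ _ _ hP hQ Yy)).
  exact: (sl2_long_commute hP hQ hS hk mh mk (Hw _ _ _ hP hQ Yy)).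
case: (root_cases kh) => [apkh|eh]; last first.
  subst h; have [m [q [mq km kq]]] := short_away k.
  have [w Hw] := movable_short apij mq; exists w; apply: comm_elt_one => //.
  apply: sl2_commute_sl2 Yy' => g Xg.
    exact: (sl2_short_commute hP hQ hR (ap_neq mq) km kq (Hw _ _ _ hP hQ Yy)).
  rewrite -{2}(nK k) in Xg.
  apply: (@sl2_short_commute m q (neg k) P Q S _ _ hP hQ hS (ap_neq mq)) => //;
    rewrite ?apNl //; exact: Hw.
have [m /andP[mi mj]] := third_index St i j.
have im : ap i m by rewrite apC. have jm : ap j m by rewrite apC.
exists 1; rewrite mul1g invg1 mulg1; apply: (NV).
have := @sl2_transfer R S k h y' y N hR hS kh nN Yy'.
move=> /(_ (fun u Mu => NV _ _ (CM' _ _ Cy Mu))) H.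
have := H _ 1; rewrite mul1g invg1 mulg1; apply=> {H}.
have [w Hw] := movable_short apkh jm; exists w; apply: (NV).
have [g1 Xg1 [g2 Xg2 <-]] := Hw _ _ _ hR hS Yy'.
have [Qt [p [pM pk]]] := quotient_exists nN.
apply/pk; rewrite (morph_comm pM); apply/comm_elt1P; rewrite /y !(morph_comm pM).
have ji : ap j i by rewrite apC. have mj' : ap m j by [].
move: Xx Xx' Xg1 Xg2; rewrite !root_short // => -[a Pa <-] [b Qb <-] [r Rr <-] [s Ss <-].
apply: (short_short_commute hP hQ hR hS pM) => // u v Mu Mv; apply/comm_elt1P;
  rewrite -(morph_comm pM); apply/pk; last exact: MC'.
exact: comm_subgroupE.
Qed.

End MultipleCommutators.

End UnitarySteinberg.

(** * Arbitrary bracketings *)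

Section BracketingTheorem.
Local Open Scope classical_set_scope.
Local Open Scope group_scope.
Variables (A : pzRingType) (F : formRing A) (I : eqType).
Variables (neg : I -> I) (c : I -> A) (G : groupType).
Variables (t : I -> I -> A -> G) (l : I -> A -> G).
Hypothesis St : unitary_relations F neg c t l.
Hypothesis Gen : forall x, rel_FU neg t l (top_ideal F) x.
Variable P : nat -> set A * set A.
Notation EU' := (rel_EU neg t l).
Notation com := (@comm_subgroup G).
Notation evalC b s := (eval_bracketing com (fun i => EU' (P i)) b s).
Notation evalP b s := (eval_bracketing (form_prod F) P b s).

Lemma eval_form_ideal b s :
  (forall i, (s <= i < s + size_bracketing b)%N -> is_form_ideal F (P i)) ->
  is_form_ideal F (evalP b s).
Proof.
elim: b s => [|bl IHl br IHr] s /= H; first by apply: H; lia.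
by apply: form_prod_form; [apply: IHl|apply: IHr] => i Hi; apply: H; lia.
Qed.

(** Each half of the bracketing is, by induction, one group [EU] or the
    commutator of two of them; the outer commutator then has at most four
    factors, and the triple and quadruple formulas apply. *)
Lemma eval_commutator b s :
  (forall i, (s <= i < s + size_bracketing b)%N -> is_form_ideal F (P i)) ->
  evalC b s = match b with
    | Single => EU' (P s)
    | Bracket bl br =>
        com (EU' (evalP bl s)) (EU' (evalP br (s + size_bracketing bl)%N))
    end.
Proof.
elim: b s => [//|bl IHl br IHr] s H.
have Hl i : (s <= i < s + size_bracketing bl)%N -> is_form_ideal F (P i).
  by move=> Hi; apply: H => /=; lia.
have Hr i : (s + size_bracketing bl <= i < s + size_bracketing bl + size_bracketing br)%N ->
    is_form_ideal F (P i).
  by move=> Hi; apply: H => /=; lia.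
rewrite /= IHl // IHr //.
have part b' s' : (forall i, (s' <= i < s' + size_bracketing b')%N -> is_form_ideal F (P i)) ->
   match b' with Single => True | Bracket b1 b2 =>
     is_form_ideal F (evalP b1 s') /\ is_form_ideal F (evalP b2 (s' + size_bracketing b1)%N) end.
  case: b' => //= b1 b2 Hb; split; apply: eval_form_ideal => i Hi; apply: Hb; lia.
move: (part _ _ Hl) (part _ _ Hr) (eval_form_ideal Hl) (eval_form_ideal Hr).
case: (bl) => [|l1 l2] /=; case: (br) => [|r1 r2] //=.
- move=> _ [h1 h2] h3 h4.
  by rewrite comm_subgroupC (triple_commutator St Gen) // comm_subgroupC.
- by move=> [h1 h2] _ h3 h4; rewrite (triple_commutator St Gen).
- by move=> [h1 h2] [h3 h4] _ _; rewrite (quadruple_commutator St Gen).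
Qed.

End BracketingTheorem.

(** * The elementary unitary group *)

Section Matrices.
Local Open Scope classical_set_scope.
Local Open Scope ring_scope.
Variables (n : nat) (A : pzRingType) (F : formRing A).
Notation I := 'I_(2 * n).
Notation neg := (@rev_ord (2 * n)).
Notation bar := (bar F).
Notation lam := (lam F).
Notation ap := (apart neg).
Notation L := (Lambda F).

(** With these coefficients the power of the form constant in a short
    transvection becomes [lam_coeff j * bar (lam_coeff i)], without exponents that
    depend on signs. *)
Definition lam_coeff (i : I) : A := if (i < n)%N then lam else 1.

Lemma lam_coeff_central i a : lam_coeff i * a = a * lam_coeff i.
Proof. by rewrite /lam_coeff; case: ifP => _; rewrite ?lam_central // mul1r mulr1. Qed.

Lemma lam_coeff_unit i : lam_coeff i * bar (lam_coeff i) = 1.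
Proof. by rewrite /lam_coeff; case: ifP => _; rewrite ?lam_bar // bar1 mulr1. Qed.

Lemma lam_coeff_unit' i : bar (lam_coeff i) * lam_coeff i = 1.
Proof. by rewrite -lam_coeff_central lam_coeff_unit. Qed.

Lemma bar_lam_coeff_central i a : bar (lam_coeff i) * a = a * bar (lam_coeff i).
Proof. by rewrite -[a](barK F) -!barM lam_coeff_central. Qed.

Lemma lam_coeff_neg i : lam_coeff i * lam_coeff (neg i) = lam.
Proof.
rewrite /lam_coeff /=; have h3 := ltn_ord i.
case: (ltnP i n) => h1; case: (ltnP (2 * n - i.+1) n) => h2;
  rewrite ?mulr1 ?mul1r //; exfalso; lia.
Qed.

Lemma lam_coeff_negE i : lam_coeff (neg i) = bar (lam_coeff i) * lam.
Proof. by rewrite -(lam_coeff_neg i) mulrA lam_coeff_unit' mul1r. Qed.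

Lemma lamz_short (i j : I) :
  lamz F ((eps j - eps i) %/ 2)%Z = lam_coeff j * bar (lam_coeff i).
Proof.
rewrite /eps /lam_coeff; case: (j < n)%N; case: (i < n)%N => /=.
- by rewrite expr0 lam_bar.
- by rewrite expr1 bar1 mulr1.
- by rewrite expr1 mul1r.
- by rewrite expr0 bar1 mulr1.
Qed.

Lemma lamz_long (i : I) : lamz F ((- (eps i + 1)) %/ 2)%Z = bar (lam_coeff i).
Proof. by rewrite /eps /lam_coeff; case: (i < n)%N => /=; rewrite ?expr1 ?expr0 ?bar1. Qed.

Definition emx (i j : I) (a : A) : 'M[A]_(2 * n) := a *: delta_mx i j.

Lemma emx_mul i j k h a b :
  emx i j a *m emx k h b = if j == k then emx i h (a * b) else 0.
Proof.
apply/matrixP => x y; rewrite !mxE (bigD1 j) //= big1 ?addr0; last first.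
  by move=> z /negbTE zj; rewrite !mxE zj andbF mulr0 mul0r.
rewrite !mxE eqxx andbT; case: (j == k); rewrite !mxE /=; last by rewrite !mulr0.
by case: (x == i); case: (y == h); rewrite /= ?mulr1 ?mulr0 ?mul0r.
Qed.

Lemma emx0 i j : emx i j 0 = 0. Proof. by rewrite /emx scale0r. Qed.
Lemma emxN i j a : emx i j (- a) = - emx i j a. Proof. by rewrite /emx scaleNr. Qed.
Lemma emxD i j a b : emx i j (a + b) = emx i j a + emx i j b. Proof. by rewrite /emx scalerDl. Qed.

(** Entry of a short transvection at [(-j, -i)]; the map from [(i, j, a)] to
    [(-j, -i, dual_coeff i j a)] is an involution. *)
Definition dual_coeff i j a : A := - (lam_coeff j * bar (lam_coeff i) * bar a).

Lemma dual_coeffD i j a b : dual_coeff i j (a + b) = dual_coeff i j a + dual_coeff i j b.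
Proof. by rewrite /dual_coeff barD mulrDr opprD. Qed.

Lemma dual_coeff_mul h j i a b : dual_coeff j h b * dual_coeff i j a = lam_coeff h * bar (lam_coeff i) * bar (a * b).
Proof.
rewrite /dual_coeff mulrNN barM -!mulrA; congr (_ * _).
rewrite [bar b * _]mulrA -lam_coeff_central -!mulrA [LHS]mulrA lam_coeff_unit' mul1r.
by rewrite !mulrA bar_lam_coeff_central.
Qed.

Lemma dual_coeffK i j a : dual_coeff (neg j) (neg i) (dual_coeff i j a) = a.
Proof.
rewrite /dual_coeff barN mulrN opprK !lam_coeff_negE !barM !barK !mulrA.
rewrite -(mulrA (bar (lam_coeff i))) lam_bar mulr1 -!mulrA.
rewrite (mulrA a) -lam_coeff_central -!mulrA -bar_lam_coeff_central.
rewrite (mulrA (lam_coeff j) (lam_coeff i)) [lam_coeff j * lam_coeff i]lam_coeff_central -!mulrA.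
by rewrite (mulrA (bar (lam_coeff i))) lam_coeff_unit' mul1r mulrA lam_coeff_unit mul1r.
Qed.

Definition short_mx i j a := 1%:M + (emx i j a + emx (neg j) (neg i) (dual_coeff i j a)).
Definition long_mx i d := 1%:M + emx i (neg i) d.

Lemma T_shortE i j a : T_short F i j a = short_mx i j a.
Proof. by rewrite /T_short /short_mx /dual_coeff emxN lamz_short addrA. Qed.

Lemma T_longE i g :
  T_long i (lamz F ((- (eps i + 1)) %/ 2)%Z * g) = long_mx i (bar (lam_coeff i) * g).
Proof. by rewrite /T_long lamz_long. Qed.

Lemma rev_ordKE i : neg (neg i) = i. Proof. exact: rev_ordK. Qed.

Lemma eq_rev_ord i j : (neg i == j) = (i == neg j).
Proof. by rewrite -(inj_eq (can_inj rev_ordKE)) rev_ordKE. Qed.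

Lemma rev_ord_neqF i : ((neg i == i) = false) * ((i == neg i) = false).
Proof.
have h : (neg i == i) = false.
  apply/negP => /eqP/(congr1 val) /=; have := ltn_ord i; lia.
by rewrite [i == _]eq_sym h.
Qed.

Lemma apart_neqF i j : ap i j ->
  ((i == j) = false) * ((j == i) = false) * ((i == neg j) = false) *
  ((neg j == i) = false) * ((neg i == j) = false) * ((j == neg i) = false) *
  ((neg i == neg j) = false) * ((neg j == neg i) = false).
Proof.
move=> /andP[/negbTE h1 /negbTE h2].
rewrite !eq_rev_ord !rev_ordKE [j == neg i]eq_sym eq_rev_ord [j == i]eq_sym h1 h2.
by [].
Qed.

Lemma one_plus_mul (X Y : 'M[A]_(2 * n)) : (1%:M + X) *m (1%:M + Y) =
  1%:M + (X + Y + X *m Y).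
Proof. by rewrite mulmxDl mul1mx mulmxDr mulmx1 -!addrA (addrCA X). Qed.

Lemma short_mx_mul i j a b : ap i j -> short_mx i j a *m short_mx i j b = short_mx i j (a + b).
Proof.
move=> ij; rewrite /short_mx one_plus_mul !(mulmxDl, mulmxDr) !emx_mul.
rewrite !(apart_neqF ij, rev_ord_neqF) !addr0 dual_coeffD !emxD; congr (_ + _).
by rewrite addrACA.
Qed.

Lemma short_mx_flip i j a : short_mx i j a = short_mx (neg j) (neg i) (dual_coeff i j a).
Proof. by rewrite /short_mx dual_coeffK !rev_ordKE [X in _ + X]addrC. Qed.

Lemma long_mx_mul i k d e : i != neg k -> long_mx i d *m long_mx k e =
   1%:M + (emx i (neg i) d + emx k (neg k) e).
Proof.
by move=> ik; rewrite /long_mx one_plus_mul emx_mul eq_rev_ord (negbTE ik) addr0.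
Qed.

Lemma short_mx_comm i j k h a b : j != k -> i != h -> i != neg k -> j != neg h ->
  short_mx i j a *m short_mx k h b = short_mx k h b *m short_mx i j a.
Proof.
move=> /negbTE jk /negbTE ih /negbTE ik /negbTE jh.
have r3 : (neg i == k) = false by rewrite eq_rev_ord.
have r4 : (neg i == neg h) = false by rewrite eq_rev_ord rev_ordKE.
have r5 : (h == i) = false by rewrite eq_sym.
have r6 : (h == neg j) = false by rewrite eq_sym eq_rev_ord.
have r7 : (neg k == i) = false by rewrite eq_rev_ord eq_sym eq_rev_ord.
have r8 : (neg k == neg j) = false by rewrite eq_rev_ord rev_ordKE eq_sym.
rewrite /short_mx !one_plus_mul !(mulmxDl, mulmxDr) !emx_mul jk jh r3 r4 r5 r6 r7 r8 !addr0.
by congr (_ + _); rewrite addrC.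
Qed.

Lemma short_long_mx_comm k h j a d : h != j -> k != neg j ->
  short_mx k h a *m long_mx j d = long_mx j d *m short_mx k h a.
Proof.
move=> /negbTE hj /negbTE kj.
have r1 : (neg k == j) = false by rewrite eq_rev_ord.
have r2 : (neg j == k) = false by rewrite eq_sym.
have r3 : (neg j == neg h) = false by rewrite eq_rev_ord rev_ordKE eq_sym.
rewrite /short_mx /long_mx !one_plus_mul !(mulmxDl, mulmxDr) !emx_mul hj r1 r2 r3 !addr0.
by congr (_ + _); rewrite addrC.
Qed.

Lemma short_mx_rel_mul i j h a b : ap i j -> ap j h -> ap i h ->
  short_mx i j a *m short_mx j h b = short_mx i h (a * b) *m (short_mx j h b *m short_mx i j a).
Proof.
move=> ij jh ih; have := dual_coeff_mul h j i a b; rewrite -[RHS]opprK -/(dual_coeff i h (a * b)) => e.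
rewrite /short_mx !one_plus_mul !(mulmxDl, mulmxDr) !emx_mul.
rewrite !(apart_neqF ij, apart_neqF jh, apart_neqF ih, rev_ord_neqF, eqxx) !(addr0, add0r).
rewrite !(emx_mul, mulmx0, mul0mx, apart_neqF ij, apart_neqF jh, apart_neqF ih, rev_ord_neqF) !(addr0, add0r).
rewrite e (emxN _ _ (dual_coeff i h (a * b))); congr (_ + _).
by rewrite [RHS]addrACA subrr addr0 [RHS]addrC; congr (_ + _); exact: addrC.
Qed.

Lemma long_coeff i x : bar (lam_coeff i) * (lam_coeff i * x - lam * bar (lam_coeff i * x)) =
  x - lam_coeff (neg i) * bar (lam_coeff i) * bar x.
Proof.
rewrite mulrBr mulrA lam_coeff_unit' mul1r barM lam_coeff_negE; congr (_ - _).
by rewrite -(bar_lam_coeff_central i (bar x)) !mulrA.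
Qed.

Lemma short_mx_rel_long i j a b : ap i j ->
  short_mx i j a *m short_mx j (neg i) b =
  long_mx i (bar (lam_coeff i) * (lam_coeff i * a * b - lam * bar (lam_coeff i * a * b)))
    *m (short_mx j (neg i) b *m short_mx i j a).
Proof.
move=> ij; rewrite -[lam_coeff i * a * b]mulrA long_coeff -(dual_coeff_mul _ j).
rewrite /short_mx /long_mx !one_plus_mul !(mulmxDl, mulmxDr) !emx_mul !rev_ordKE.
rewrite !(emx_mul, mulmx0, mul0mx, apart_neqF ij, rev_ord_neqF, eqxx) !(addr0, add0r).
rewrite ?(emx_mul, mulmx0, mul0mx, apart_neqF ij, rev_ord_neqF, eqxx) ?(addr0, add0r).
rewrite emxD (emxN i (neg i)); congr (_ + _).
by rewrite [RHS]addrACA addNr addr0 [RHS]addrC; congr (_ + _); exact: addrC.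
Qed.

Lemma dual_coeff_long i j a g : L g ->
  dual_coeff i (neg j) (bar (lam_coeff j) * a * g) = - (bar (lam_coeff j) * g * dual_coeff i j a).
Proof.
move=> Lg; rewrite /dual_coeff mulrN opprK !barM barK lam_coeff_negE.
have eg : lam * bar g = - g by rewrite {2}(Lambda_maxE Lg) opprK.
rewrite !mulrA -(lam_coeff_central j) !mulrA lam_coeff_unit mul1r.
rewrite -(mulrA _ (bar (lam_coeff i))) bar_lam_coeff_central mulrA eg.
rewrite (bar_lam_coeff_central j) -(mulrA g) lam_coeff_unit' mulr1.
by rewrite !mulNr opprK.
Qed.

Lemma long_dual_coeff i j a g :
  bar (lam_coeff j) * a * g * dual_coeff i j a = - (bar (lam_coeff i) * (a * g * bar a)).
Proof.
rewrite /dual_coeff mulrN; congr (- _); rewrite !mulrA -(lam_coeff_central j) !mulrA lam_coeff_unit mul1r.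
by rewrite -(bar_lam_coeff_central i (a * g)) !mulrA.
Qed.

Lemma short_long_mx_rel i j a g : ap i j -> L g ->
  short_mx i j a *m long_mx j (bar (lam_coeff j) * g) =
  short_mx i (neg j) (bar (lam_coeff j) * a * g) *m long_mx i (bar (lam_coeff i) * (a * g * bar a))
    *m (long_mx j (bar (lam_coeff j) * g) *m short_mx i j a).
Proof.
move=> ij Lg; rewrite /short_mx /long_mx !one_plus_mul !(mulmxDl, mulmxDr) !emx_mul !rev_ordKE.
rewrite !(emx_mul, mulmx0, mul0mx, apart_neqF ij, rev_ord_neqF, eqxx) !(addr0, add0r).
rewrite ?(emx_mul, mulmx0, mul0mx, apart_neqF ij, rev_ord_neqF, eqxx) ?(addr0, add0r).
rewrite (dual_coeff_long _ _ _ Lg) long_dual_coeff (mulrA a) -(bar_lam_coeff_central j a).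
rewrite (emxN j (neg i)) (emxN i (neg i)); congr (_ + _).
rewrite [X in _ = X - _]addrAC addrK [RHS]addrACA addNr addr0 [RHS]addrC.
by congr (_ + _); exact: addrC.
Qed.

Hypothesis hn : (3 <= n)%N.

Lemma third_ord (i j : I) : exists h, ap h i && ap h j.
Proof.
have [hi hj] := (ltn_ord i, ltn_ord j).
have [k [k3 ki ki' kj kj']] : exists k, [/\ (k < 3)%N, k != i, k != 2 * n - i.+1,
    k != j & k != 2 * n - j.+1]%N.
  have : [|| [&& 0 != i, 0 != 2 * n - i.+1, 0 != j & 0 != 2 * n - j.+1],
    [&& 1 != i, 1 != 2 * n - i.+1, 1 != j & 1 != 2 * n - j.+1]
    | [&& 2 != i, 2 != 2 * n - i.+1, 2 != j & 2 != 2 * n - j.+1]]%N by lia.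
  by move=> /or3P[]/and4P[*]; [exists 0%N|exists 1%N|exists 2%N].
have kn : (k < 2 * n)%N by lia.
by exists (Ordinal kn); rewrite /apart -!val_eqE /= ki ki' kj kj'.
Qed.

Lemma long_mx_add i d e : long_mx i d *m long_mx i e = long_mx i (d + e).
Proof. by rewrite long_mx_mul ?rev_ord_neqF // /long_mx emxD. Qed.

Section Relations.
Variables (G : groupType) (mx : G -> 'M[A]_(2 * n)).
Hypothesis mxM : forall x y, mx (x * y)%g = mx x *m mx y.
Hypothesis mxI : injective mx.
Variables (t : I -> I -> A -> G) (l : I -> A -> G).
Hypothesis mx_t : forall i j a, ap i j -> mx (t i j a) = short_mx i j a.
Hypothesis mx_l : forall i g, L g -> mx (l i g) = long_mx i (bar (lam_coeff i) * g).

Lemma comm_eltI (x y z : G) : (x * y = z * (y * x))%g -> comm_elt x y = z.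
Proof. by move=> e; rewrite /comm_elt e !mulgA !mulgK. Qed.

(** The relations hold for any group with an injective multiplicative map to
    matrices that sends the generators to transvections; stating them in this
    way keeps the inverse matrices stored in [GL] out of the computations. *)
Lemma matrix_relations : unitary_relations F neg lam_coeff t l.
Proof.
split.
- exact: rev_ordKE.
- by move=> i; rewrite rev_ord_neqF.
- exact: third_ord.
- exact: lam_coeff_central.
- exact: lam_coeff_unit.
- exact: lam_coeff_neg.
- move=> i j a ij; apply: mxI.
  have ij' : ap (neg j) (neg i) by rewrite /apart !(apart_neqF ij) rev_ordKE (apart_neqF ij).
  by rewrite (mx_t _ ij) (mx_t _ ij') short_mx_flip.
- by move=> i j a b ij; apply: mxI; rewrite mxM !(mx_t _ ij) short_mx_mul.
- move=> i a b La Lb; apply: mxI; have Lab := zmodD (Lambda_subgroup F) La Lb.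
  by rewrite mxM (mx_l _ La) (mx_l _ Lb) (mx_l _ Lab) long_mx_add mulrDr.
- move=> i j k h a b ij kh jk ih ik jh; apply: mxI.
  by rewrite !mxM (mx_t _ ij) (mx_t _ kh) short_mx_comm.
- move=> i j h a b ij jh ih; apply: comm_eltI; apply: mxI.
  by rewrite !mxM (mx_t _ ij) (mx_t _ jh) (mx_t _ ih) short_mx_rel_mul.
- move=> i j a b ij; apply: comm_eltI; apply: mxI.
  have jni : ap j (neg i) by rewrite /apart rev_ordKE !(apart_neqF ij).
  have Lx := Lambda_minE F (lam_coeff i * a * b).
  by rewrite !mxM (mx_t _ ij) (mx_t _ jni) (mx_l _ Lx) short_mx_rel_long.
- move=> i j a g ij Lg; apply: comm_eltI; apply: mxI.
  have inj' : ap i (neg j) by rewrite /apart rev_ordKE !(apart_neqF ij).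
  have Lx := Lambda_bar a Lg.
  by rewrite !mxM (mx_t _ ij) (mx_t _ inj') (mx_l _ Lx) (mx_l _ Lg) short_long_mx_rel.
- move=> i k g d ik Lg Ld; apply: mxI.
  have ki : k != neg i by rewrite eq_sym eq_rev_ord.
  by rewrite !mxM (mx_l _ Lg) (mx_l _ Ld) (long_mx_mul _ _ ik) (long_mx_mul _ _ ki) [X in _ + X = _]addrC.
- move=> k h j a g kh hj kj Lg; apply: mxI.
  by rewrite !mxM (mx_t _ kh) (mx_l _ Lg) short_long_mx_comm.
Qed.

End Relations.

Definition mkGL (x y : 'M[A]_(2 * n)) : GL (2 * n) A := insubd (GL_one (2 * n) A) (x, y).

Lemma mkGL_mx x y : x *m y = 1%:M -> y *m x = 1%:M -> GLmx (mkGL x y) = x.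
Proof. by move=> xy yx; rewrite /GLmx /mkGL insubdK //= /in_mem /= xy yx eqxx. Qed.

Lemma short_mx0 i j : short_mx i j 0 = 1%:M.
Proof. by rewrite /short_mx /dual_coeff bar0 mulr0 oppr0 !emx0 !addr0. Qed.

Lemma long_mx0 i : long_mx i 0 = 1%:M.
Proof. by rewrite /long_mx emx0 addr0. Qed.

Lemma GLmx_mul (g h : GL (2 * n) A) : GLmx (g * h)%g = GLmx g *m GLmx h.
Proof. by []. Qed.

Definition GL_short i j a := mkGL (short_mx i j a) (short_mx i j (- a)).
Definition GL_long i g := mkGL (long_mx i (bar (lam_coeff i) * g)) (long_mx i (- (bar (lam_coeff i) * g))).

Lemma GL_short_mx i j a : ap i j -> GLmx (GL_short i j a) = short_mx i j a.
Proof. by move=> ij; apply: mkGL_mx; rewrite short_mx_mul // ?subrr ?addNr short_mx0. Qed.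

Lemma GL_long_mx i g : GLmx (GL_long i g) = long_mx i (bar (lam_coeff i) * g).
Proof. by apply: mkGL_mx; rewrite long_mx_add // ?subrr ?addNr long_mx0. Qed.

Lemma T_generatorsE P : is_form_ideal F P -> T_generators F P =
  [set g | (exists i j a, [/\ ap i j, P.1 a & g = GL_short i j a]) \/
           exists i d, P.2 d /\ g = GL_long i d].
Proof.
move=> hP; apply/seteqP; split=> g.
  case=> [[i [j [a [ij ij' Pa eg]]]]|[i [d [Pd eg]]]]; [left|right].
    have apij : ap i j by rewrite /apart ij ij'.
    exists i, j, a; split=> //; apply: GLmx_inj.
    by rewrite GL_short_mx // eg T_shortE.
  by exists i, d; split=> //; apply: GLmx_inj; rewrite GL_long_mx // eg T_longE.
case=> [[i [j [a [ij Pa ->]]]]|[i [d [Pd ->]]]]; [left|right].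
  exists i, j, a; case/andP: (ij) => ? ?; split=> //.
  by rewrite GL_short_mx // T_shortE.
by exists i, d; split=> //; rewrite GL_long_mx // T_longE.
Qed.

Section Instance.
Variables (E' : groupType) (v : E' -> GL (2 * n) A) (u : GL (2 * n) A -> E').
Hypothesis vM : {morph v : x y / (x * y)%g}.
Hypothesis vI : injective v.
Hypothesis vE : forall x, EU_abs n F (v x).
Hypothesis uK : forall g, EU_abs n F g -> v (u g) = g.

Notation t' := (fun i j a => u (GL_short i j a)).
Notation l' := (fun i g => u (GL_long i g)).

Let topI := top_ideal_form F.

Lemma GL_short_EU i j a : ap i j -> EU_abs n F (GL_short i j a).
Proof.
move=> ij; apply: (@sub_group_span _ (T_generators F (top_ideal F))).
by rewrite T_generatorsE //; left; exists i, j, a.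
Qed.

Lemma GL_long_EU i g : L g -> EU_abs n F (GL_long i g).
Proof.
move=> Lg; apply: (@sub_group_span _ (T_generators F (top_ideal F))).
by rewrite T_generatorsE //; right; exists i, g.
Qed.

Lemma v_short i j a : ap i j -> v (u (GL_short i j a)) = GL_short i j a.
Proof. by move=> ij; apply: uK; apply: GL_short_EU. Qed.

Lemma v_long i g : L g -> v (u (GL_long i g)) = GL_long i g.
Proof. by move=> Lg; apply: uK; apply: GL_long_EU. Qed.

Lemma EU_unitary_relations : unitary_relations F neg lam_coeff t' l'.
Proof.
apply: (@matrix_relations _ (fun x => GLmx (v x))).
- by move=> x y; rewrite vM GLmx_mul.
- by move=> x y /GLmx_inj/vI.
- by move=> i j a ij; rewrite v_short // GL_short_mx.
- by move=> i g Lg; rewrite v_long // GL_long_mx.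
Qed.

Lemma image_root_gens P : is_form_ideal F P ->
  v @` root_gens neg t' l' P = T_generators F P.
Proof.
move=> hP; rewrite T_generatorsE //; apply/seteqP; split=> g.
  move=> [x [i [j [ij]]] + <-]; case: (root_cases EU_unitary_relations ij) => [apij|->].
    rewrite (root_short EU_unitary_relations) // => -[a Pa <-]; left; exists i, j, a.
    by rewrite v_short.
  rewrite root_long => -[d Pd <-]; right; exists i, d; rewrite v_long //.
  exact: (param_Lambda hP).
case=> [[i [j [a [ij Pa ->]]]]|[i [d [Pd ->]]]].
  exists (u (GL_short i j a)); last by rewrite v_short.
  exists i, j; split; first exact: ap_neq ij.
  exact: (mem_short EU_unitary_relations).
exists (u (GL_long i d)); last by rewrite v_long //; apply: (param_Lambda hP).
exists i, (neg i); split; first by rewrite rev_ord_neqF.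
exact: mem_long.
Qed.

Lemma image_rel_FU P : is_form_ideal F P -> v @` rel_FU neg t' l' P = FU F P.
Proof. by move=> hP; rewrite /rel_FU (image_span vM) image_root_gens. Qed.

Lemma image_setT : v @` [set: E'] = EU_abs n F.
Proof.
apply/seteqP; split=> [_ [x _ <-] //|g Eg]; exists (u g) => //; exact: uK.
Qed.

Lemma image_rel_EU P : is_form_ideal F P -> v @` rel_EU neg t' l' P = EU n F P.
Proof. by move=> hP; rewrite /rel_EU (image_normal_closure vM) image_rel_FU // image_setT. Qed.

Lemma generated x : rel_FU neg t' l' (top_ideal F) x.
Proof.
have : (v @` rel_FU neg t' l' (top_ideal F)) (v x).
  by rewrite (image_rel_FU topI); exact: vE.
by case=> y Fy /vI <-.
Qed.

End Instance.

End Matrices.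

Section ImageOfBracketing.
Local Open Scope classical_set_scope.
Local Open Scope group_scope.

Lemma image_eval_bracketing (G H : groupType) (v : G -> H) (f : nat -> set G) (g : nat -> set H) b s :
  {morph v : x y / (x * y)%g} ->
  (forall i, (s <= i < s + size_bracketing b)%N -> v @` f i = g i) ->
  v @` eval_bracketing (@comm_subgroup G) f b s = eval_bracketing (@comm_subgroup H) g b s.
Proof.
move=> vM; elim: b s => [|bl IHl br IHr] s /= H1; first by apply: H1; lia.
by rewrite (image_comm vM) IHl ?IHr // => i Hi; apply: H1; lia.
Qed.

End ImageOfBracketing.

Theorem theorem8
  (n : nat) (hn : (3 <= n)%N)
  (R : comPzRingType) (A : pzRingType) (phi : {rmorphism R -> A})
  (halg : is_algebra phi)
  (F : formRing A) (hF : is_form_algebra phi F) (hqf : quasi_finite phi)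
  (m : nat) (hm : (1 <= m)%N)
  (I Gamma : nat -> set A)
  (hI : forall i : nat, (i <= m)%N -> is_form_ideal F (I i, Gamma i))
  (b bl br : bracketing) (k : nat)
  (hb : size_bracketing b = m.+1)
  (hsplit : b = Bracket bl br)
  (hk : size_bracketing bl = k.+1) :
  eval_bracketing (@comm_subgroup (GL (2 * n) A))
    (fun i => EU n F (I i, Gamma i)) b 0
  = comm_subgroup
      (EU n F (eval_bracketing (form_prod F)
                 (fun i => (I i, Gamma i)) bl 0))
      (EU n F (eval_bracketing (form_prod F)
                 (fun i => (I i, Gamma i)) br k.+1)).
Proof.
have sE : subgroup (EU_abs n F) by exact: span_subgroup.
have [E' [v [u [vM vI vE uK]]]] := subgroup_exists sE.
have St := EU_unitary_relations hn vM vI uK.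
have Gen := generated hn vM vI vE uK.
pose P i := (I i, Gamma i).
have hP i : (0 <= i < 0 + size_bracketing b)%N -> is_form_ideal F (P i).
  by move=> Hi; apply: hI; lia.
have image i := image_rel_EU hn vM vI vE uK (P := i).
rewrite -(@image_eval_bracketing _ _ v
   (fun i => rel_EU (@rev_ord (2 * n)) (fun i j a => u (GL_short F i j a)) (fun i g => u (GL_long F i g)) (P i)) _ b 0 vM); last first.
  by move=> i Hi; apply: image; apply: hP.
rewrite (eval_commutator St Gen) // hsplit (image_comm vM) !image ?hk //.
  by apply: eval_form_ideal => i Hi; apply: hP; rewrite hsplit /=; lia.
by apply: eval_form_ideal => i Hi; apply: hP; rewrite hsplit /=; lia.
Qed.
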